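(* The cut rule is admissible for system $\mathcal D$: every sequent derivable in $\mathcal D$ has a derivation in $\mathcal D$ without instances of the cut rule.
   Context: Fix countably infinite sets of names and variables and the constructors $\mathsf{pub}$ (unary) and $\mathsf{sign},\mathsf{blind},\langle\cdot,\cdot\rangle,\{\cdot\}_{\cdot}$ (binary). Let $E$ be the union of AC-convergent equational theories $E_1,\dots,E_n$ with pairwise disjoint signatures $\Sigma_{E_i}$, all disjoint from the constructors, each containing at most one associative-commutative (AC) binary symbol $\oplus_i$; $E$ is presented by a rewrite system $R_E$ terminating and confluent modulo AC; $\Sigma_E=\bigcup_i\Sigma_{E_i}$. Terms: names, variables, $\mathsf{pub}(M)$, $\mathsf{sign}(M,N)$, $\mathsf{blind}(M,N)$, $\langle M,N\rangle$, $\{M\}_N$, $g(M_1,\dots,M_j)$ with $g\in\Sigma_E$; all ground. $\equiv$ is equality modulo AC of all $\oplus_i$; $\approx_E$ equality modulo $E$. A term is guarded if it is a name, a variable, or headed by a constructor. An $E_i$-context is a term with holes built only from function symbols of $\Sigma_{E_i}$. A subterm occurrence $N$ of $M$ is a cross-theory subterm if $N$ is headed by a symbol of some $\Sigma_{E_i}$ and is an immediate argument of a subterm of $M$ headed by a symbol of $\Sigma_{E_j}$, $j\neq i$. A sequent $\Gamma\vdash M$: finite set $\Gamma$ of terms and term $M$, all in $R_E$-normal form modulo AC; $\Gamma,M$ means $\Gamma\cup\{M\}$. System $\mathcal D$ has the rules: ($id_{E_i}$, for each $i$) $\Gamma\vdash M$ with no premise if $M\approx_E C[M_1,\dots,M_k]$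 for some $E_i$-context $C$ and $M_1,\dots,M_k\in\Gamma$; (cut) from $\Gamma\vdash M$ and $\Gamma,M\vdash T$ infer $\Gamma\vdash T$; ($p_L$) from $\Gamma,\langle M,N\rangle,M,N\vdash T$ infer $\Gamma,\langle M,N\rangle\vdash T$; ($p_R$) from $\Gamma\vdash M$, $\Gamma\vdash N$ infer $\Gamma\vdash\langle M,N\rangle$; ($e_L$) from $\Gamma,\{M\}_K\vdash K$ and $\Gamma,\{M\}_K,M,K\vdash N$ infer $\Gamma,\{M\}_K\vdash N$; ($e_R$) from $\Gamma\vdash M$, $\Gamma\vdash K$ infer $\Gamma\vdash\{M\}_K$; ($\mathsf{sign}_L$) from $\Gamma,\mathsf{sign}(M,K),\mathsf{pub}(L),M\vdash N$ infer $\Gamma,\mathsf{sign}(M,K),\mathsf{pub}(L)\vdash N$, provided $K\equiv L$; ($\mathsf{sign}_R$) from $\Gamma\vdash M$, $\Gamma\vdash K$ infer $\Gamma\vdash\mathsf{sign}(M,K)$; ($\mathsf{blind}_{L1}$) from $\Gamma,\mathsf{blind}(M,K)\vdash K$ and $\Gamma,\mathsf{blind}(M,K),M,K\vdash N$ infer $\Gamma,\mathsf{blind}(M,K)\vdash N$; ($\mathsf{blind}_R$) from $\Gamma\vdash M$, $\Gamma\vdash K$ infer $\Gamma\vdash\mathsf{blind}(M,K)$; ($\mathsf{blind}_{L2}$) from $\Gamma,\mathsf{sign}(\mathsf{blind}(M,R),K)\vdash R$ and $\Gamma,\mathsf{sign}(\mathsf{blind}(M,R),K),\mathsf{sign}(M,K),R\vdash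 N$ infer $\Gamma,\mathsf{sign}(\mathsf{blind}(M,R),K)\vdash N$; ($gs$) from $\Gamma\vdash A$ and $\Gamma,A\vdash M$ infer $\Gamma\vdash M$, provided $A$ is a guarded subterm of a term in $\Gamma\cup\{M\}$; ($cs$) from $\Gamma\vdash N$ and $\Gamma,N\vdash M$ infer $\Gamma\vdash M$, provided $N$ is a cross-theory subterm of a term in $\Gamma\cup\{M\}$. *)

(* Defs.v *)
From Stdlib Require Import List Relations.
Import ListNotations.
Set Implicit Arguments.

Inductive term (S : Type) : Type :=
| Name  : nat -> term S
| Var   : nat -> term S
| Pub   : term S -> term S
| Sign  : term S -> term S -> term S
| Blind : term S -> term S -> term S
| Pair  : term S -> term S -> term S
| Enc   : term S -> term S -> term S   (* {M}_K = Enc M K *)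
| Fn    : S -> list (term S) -> term S.

Arguments Name {S}. Arguments Var {S}.

(** The data of the equational theory E = E_1 u ... u E_n. *)
Record theory_data := {
  sym : Type;
  arity : sym -> nat;
  thy : sym -> nat;                 (* f belongs to Sigma_{E_(thy f)} *)
  isAC : sym -> bool;
  ntheories : nat;
  rules : nat -> term sym -> term sym -> Prop  (* rules i l r : l -> r in R_{E_i} *)
}.

Section D.
Variable T : theory_data.
Local Notation S := (sym T).
Local Notation tm := (term S).

Fixpoint subst (s : nat -> tm) (t : tm) : tm :=
  match t with
  | Name a => Name a
  | Var x => s x
  | Pub M => Pub (subst s M)
  | Sign M N => Sign (subst s M) (subst s N)
  | Blind M N => Blind (subst s M) (subst s N)
  | Pair M N => Pair (subst s M) (subst s N)
  | Enc M N => Enc (subst s M) (subst s N)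
  | Fn f l => Fn f (map (subst s) l)
  end.

Inductive wf : tm -> Prop :=
| wf_name a : wf (Name a)
| wf_var x : wf (Var x)
| wf_pub M : wf M -> wf (Pub M)
| wf_sign M N : wf M -> wf N -> wf (Sign M N)
| wf_blind M N : wf M -> wf N -> wf (Blind M N)
| wf_pair M N : wf M -> wf N -> wf (Pair M N)
| wf_enc M N : wf M -> wf N -> wf (Enc M N)
| wf_fn f l : length l = arity T f -> (forall t, In t l -> wf t) -> wf (Fn f l).

Inductive pure (i : nat) : tm -> Prop :=
| pure_var x : pure i (Var x)
| pure_fn f l : thy T f = i -> (forall t, In t l -> pure i t) -> pure i (Fn f l).

Inductive ctx_step (P : tm -> tm -> Prop) : tm -> tm -> Prop :=
| cs_base M N : P M N -> ctx_step P M N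
| cs_pub M N : ctx_step P M N -> ctx_step P (Pub M) (Pub N)
| cs_sign1 M N K : ctx_step P M N -> ctx_step P (Sign M K) (Sign N K)
| cs_sign2 M N K : ctx_step P M N -> ctx_step P (Sign K M) (Sign K N)
| cs_blind1 M N K : ctx_step P M N -> ctx_step P (Blind M K) (Blind N K)
| cs_blind2 M N K : ctx_step P M N -> ctx_step P (Blind K M) (Blind K N)
| cs_pair1 M N K : ctx_step P M N -> ctx_step P (Pair M K) (Pair N K)
| cs_pair2 M N K : ctx_step P M N -> ctx_step P (Pair K M) (Pair K N)
| cs_enc1 M N K : ctx_step P M N -> ctx_step P (Enc M K) (Enc N K)
| cs_enc2 M N K : ctx_step P M N -> ctx_step P (Enc K M) (Enc K N)
| cs_fn f l1 l2 M N : ctx_step P M N ->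
    ctx_step P (Fn f (l1 ++ M :: l2)) (Fn f (l1 ++ N :: l2)).

Definition ac_ax (A : S -> bool) (M N : tm) : Prop :=
  exists f x y z, A f = true /\
    ((M = Fn f [x; Fn f [y; z]] /\ N = Fn f [Fn f [x; y]; z]) \/
     (M = Fn f [x; y] /\ N = Fn f [y; x])).

Definition acEq (A : S -> bool) : relation tm :=
  clos_refl_sym_trans tm (ctx_step (ac_ax A)).

Definition rule_inst (R : tm -> tm -> Prop) (M N : tm) : Prop :=
  exists l r s, R l r /\ M = subst s l /\ N = subst s r.

Definition rstep (R : tm -> tm -> Prop) (A : S -> bool) (M N : tm) : Prop :=
  exists M' N', acEq A M M' /\ ctx_step (rule_inst R) M' N' /\ acEq A N' N.

Definition terminating_mod (R : tm -> tm -> Prop) (A : S -> bool) : Prop :=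
  forall M, wf M -> Acc (fun N M0 => wf M0 /\ rstep R A M0 N) M.

Definition confluent_mod (R : tm -> tm -> Prop) (A : S -> bool) : Prop :=
  forall M N1 N2, wf M ->
    clos_refl_trans tm (rstep R A) M N1 ->
    clos_refl_trans tm (rstep R A) M N2 ->
    exists P1 P2, clos_refl_trans tm (rstep R A) N1 P1 /\
                  clos_refl_trans tm (rstep R A) N2 P2 /\ acEq A P1 P2.

Definition convergent_mod R A := terminating_mod R A /\ confluent_mod R A.

Definition ACi (i : nat) (f : S) : bool := isAC T f && Nat.eqb (thy T f) i.
Definition RE (l r : tm) : Prop := exists i, i < ntheories T /\ rules T i l r.

Definition equiv : relation tm := acEq (isAC T).
Definition approxE : relation tm :=
  clos_refl_sym_trans tm
    (fun M N => ctx_step (rule_inst RE) M N \/ ctx_step (ac_ax (isAC T)) M N).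

Definition nf (M : tm) : Prop := wf M /\ ~ (exists N, rstep RE (isAC T) M N).
Definition nf_seq (G : list tm) (M : tm) : Prop := (forall t, In t G -> nf t) /\ nf M.

Definition valid_theory : Prop :=
  (forall f, thy T f < ntheories T) /\
  (forall f, isAC T f = true -> arity T f = 2) /\
  (forall f g, isAC T f = true -> isAC T g = true -> thy T f = thy T g -> f = g) /\
  (forall i l r, rules T i l r -> i < ntheories T /\ pure i l /\ pure i r /\ wf l /\ wf r) /\
  (forall i, i < ntheories T -> convergent_mod (rules T i) (ACi i)) /\
  convergent_mod RE (isAC T).

(** E_i-contexts filled with members of G: C[M1,...,Mk] with Mj in G *)
Inductive ctx_inst (i : nat) (G : list tm) : tm -> Prop :=
| ci_hole M : In M G -> ctx_inst i G M
| ci_fn f l : thy T f = i -> length l = arity T f ->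
    (forall t, In t l -> ctx_inst i G t) -> ctx_inst i G (Fn f l).

Inductive imm_sub : tm -> tm -> Prop :=
| is_pub M : imm_sub M (Pub M)
| is_sign1 M N : imm_sub M (Sign M N)
| is_sign2 M N : imm_sub N (Sign M N)
| is_blind1 M N : imm_sub M (Blind M N)
| is_blind2 M N : imm_sub N (Blind M N)
| is_pair1 M N : imm_sub M (Pair M N)
| is_pair2 M N : imm_sub N (Pair M N)
| is_enc1 M N : imm_sub M (Enc M N)
| is_enc2 M N : imm_sub N (Enc M N)
| is_fn f l M : In M l -> imm_sub M (Fn f l).

Definition subterm : relation tm := clos_refl_trans tm imm_sub.

Definition guarded (M : tm) : Prop :=
  match M with Fn _ _ => False | _ => True end.

Definition cross_sub (N M : tm) : Prop :=
  exists g l f l', subterm (Fn g l) M /\ In N l /\ N = Fn f l' /\ thy T f <> thy T g.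

(** The system D; [cut_ok] says whether the cut rule may be used.
    Contexts are lists read as finite sets: all rules only test membership,
    and "G, M" is [M :: G]. Every sequent must be in normal form. *)
Inductive der (cut_ok : bool) : list tm -> tm -> Prop :=
| r_id i G M C : nf_seq G M -> i < ntheories T ->
    ctx_inst i G C -> approxE M C -> der cut_ok G M
| r_cut G M N : cut_ok = true -> nf_seq G N ->
    der cut_ok G M -> der cut_ok (M :: G) N -> der cut_ok G N
| r_pL G M N T0 : nf_seq G T0 -> In (Pair M N) G ->
    der cut_ok (M :: N :: G) T0 -> der cut_ok G T0
| r_pR G M N : nf_seq G (Pair M N) ->
    der cut_ok G M -> der cut_ok G N -> der cut_ok G (Pair M N)
| r_eL G M K N : nf_seq G N -> In (Enc M K) G ->
    der cut_ok G K -> der cut_ok (M :: K :: G) N -> der cut_ok G N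
| r_eR G M K : nf_seq G (Enc M K) ->
    der cut_ok G M -> der cut_ok G K -> der cut_ok G (Enc M K)
| r_signL G M K L N : nf_seq G N -> In (Sign M K) G -> In (Pub L) G -> equiv K L ->
    der cut_ok (M :: G) N -> der cut_ok G N
| r_signR G M K : nf_seq G (Sign M K) ->
    der cut_ok G M -> der cut_ok G K -> der cut_ok G (Sign M K)
| r_blindL1 G M K N : nf_seq G N -> In (Blind M K) G ->
    der cut_ok G K -> der cut_ok (M :: K :: G) N -> der cut_ok G N
| r_blindR G M K : nf_seq G (Blind M K) ->
    der cut_ok G M -> der cut_ok G K -> der cut_ok G (Blind M K)
| r_blindL2 G M R K N : nf_seq G N -> In (Sign (Blind M R) K) G ->
    der cut_ok G R -> der cut_ok (Sign M K :: R :: G) N -> der cut_ok G N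
| r_gs G A M : nf_seq G M -> guarded A ->
    (exists t, (In t G \/ t = M) /\ subterm A t) ->
    der cut_ok G A -> der cut_ok (A :: G) M -> der cut_ok G M
| r_cs G N M : nf_seq G M ->
    (exists t, (In t G \/ t = M) /\ cross_sub N t) ->
    der cut_ok G N -> der cut_ok (N :: G) M -> der cut_ok G M.

End D.

(* Main.v *)
(** Call a term an alien of [t] for [E_i] if it is a maximal subterm of [t] not headed in
    [Sigma_{E_i}]. Since every [gs] or [cs] step, and every left rule, adds to the context a
    term from a finite universe, we may assume that the context [G] is saturated: it contains
    every term that can be added to it without cut. Let [synth G] be the set of terms built
    from [G] by right rules and [E_i]-contexts, where an [E_i]-headed term may use, besides
    [G], only its own aliens. By saturation a synthesised goal has a cut-free derivation,
    because these aliens are guarded or cross-theory subterms, hence already in [G]. It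
    remains to see that [synth G] is closed under all rules, cut included. For left rules this
    is inversion and saturation. For [id] the point is that rewriting to normal form a context
    filled with normal terms treats aliens as atoms: an alien that occurs neither in [G] nor
    in the result may be replaced by anything, for instance by a member of [G]. *)
Require Import Defs.
From Stdlib Require Import List Relations Arith Lia Classical ClassicalEpsilon.
Import ListNotations.
Set Implicit Arguments.

(** * Induction on terms, and auxiliary facts on lists *)

(** The generated principle gives no hypothesis for the arguments listed under [Fn]; an inner
    fixpoint over the list supplies it. *)
Lemma term_list_ind (S : Type) (P : term S -> Prop) :
  (forall a, P (Name a)) -> (forall x, P (Var x)) ->
  (forall M, P M -> P (Pub M)) ->
  (forall M N, P M -> P N -> P (Sign M N)) ->
  (forall M N, P M -> P N -> P (Blind M N)) ->
  (forall M N, P M -> P N -> P (Pair M N)) ->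
  (forall M N, P M -> P N -> P (Enc M N)) ->
  (forall f l, (forall t, In t l -> P t) -> P (Fn f l)) ->
  forall t, P t.
Proof.
  intros HN HV Hp Hs Hb Hpr He Hf.
  fix IH 1. intros [a|x|M|M N|M N|M N|M N|f l];
    [apply HN|apply HV|apply Hp|apply Hs|apply Hb|apply Hpr|apply He|apply Hf];
    try apply IH.
  revert l. fix IHl 1. intros [|u l] t Ht; [destruct Ht|].
  destruct Ht as [<-|Ht]; [apply IH|exact (IHl l t Ht)].
Qed.

Lemma list_choice (A B : Type) (R : A -> B -> Prop) (l : list A) :
  (forall x, In x l -> exists y, R x y) ->
  exists l', Forall2 R l l'.
Proof.
  induction l as [|a l IH]; intros H.
  - exists nil. constructor.
  - destruct (H a (or_introl eq_refl)) as [b Hb].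
    destruct IH as [l' Hl']. { intros x Hx. apply H. right. exact Hx. }
    exists (b :: l'). constructor; assumption.
Qed.

Lemma Forall2_in_r (A B : Type) (R : A -> B -> Prop) l l' y :
  Forall2 R l l' -> In y l' -> exists x, In x l /\ R x y.
Proof.
  induction 1 as [|a b l l' Hab _ IH]; intros Hin; [destruct Hin|].
  destruct Hin as [<-|Hin]; [exists a; simpl; auto|].
  destruct (IH Hin) as [x [? ?]]. exists x. simpl. auto.
Qed.

Lemma in_mid (A : Type) (x y : A) l1 l2 :
  In x (l1 ++ y :: l2) <-> x = y \/ In x (l1 ++ l2).
Proof. rewrite !in_app_iff. simpl. intuition congruence. Qed.

Section Theory.
Variable T : theory_data.
Local Notation tm := (term (sym T)).
Local Notation subst := (Defs.subst T).
Local Notation wf := (wf T).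
Local Notation pure := (pure T).
Local Notation ctx_step := (ctx_step T).
Local Notation ac_ax := (ac_ax T).
Local Notation acEq := (acEq T).
Local Notation rule_inst := (rule_inst T).
Local Notation rstep := (rstep T).
Local Notation RE := (RE T).
Local Notation equiv := (Defs.equiv T).
Local Notation approxE := (approxE T).
Local Notation nf := (nf T).
Local Notation nf_seq := (nf_seq T).
Local Notation ctx_inst := (ctx_inst T).
Local Notation imm_sub := (imm_sub T).
Local Notation subterm := (subterm T).
Local Notation cross_sub := (cross_sub T).
Local Notation guarded := (guarded T).
Local Notation der := (der T).
Local Notation rstepE := (rstep RE (isAC T)).
Implicit Types (M N t u v : tm) (l L G : list tm) (i : nat).

(** * One-hole contexts, subterms and rewriting modulo AC *)

(** A one-hole context is encoded as a function. Quantifying over [P] lets the same context carry AC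
    steps and rewrite steps. *)
Definition liftable (c : tm -> tm) : Prop :=
  forall P M N, ctx_step P M N -> ctx_step P (c M) (c N).

Lemma wf_subterm N M : subterm N M -> wf M -> wf N.
Proof.
  induction 1 as [N M H| |]; auto. intros Hw. destruct H; inversion Hw; subst; auto.
Qed.

(** Turns a subterm occurrence into a context, so that a step at the occurrence becomes a step of
    the whole term. The last two clauses serve when the hole is refilled with another term. *)
Lemma subterm_ctx N M : subterm N M ->
  exists c, c N = M /\ liftable c /\ (forall t, subterm t (c t)) /\
    (wf M -> forall t, wf t -> wf (c t)).
Proof.
  induction 1 as [N M H|M|N O M _ IH1 _ IH2].
  - assert (Hs : forall t u, imm_sub t u -> subterm t u) by (intros; apply rt_step; assumption).
    destruct H as [M|M N|M N|M N|M N|M N|M N|M N|M N|f l M Hin];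
    [ exists (fun t => Pub t) | exists (fun t => Sign t N) | exists (fun t => Sign M t)
    | exists (fun t => Blind t N) | exists (fun t => Blind M t)
    | exists (fun t => Pair t N) | exists (fun t => Pair M t)
    | exists (fun t => Enc t N) | exists (fun t => Enc M t) | ].
    1-9: split; [reflexivity|]; split; [intros P t u Htu; constructor; exact Htu|];
      split; [intros t; apply Hs; constructor|
              intros Hw t Ht; inversion Hw; subst; constructor; assumption].
    apply in_split in Hin. destruct Hin as [l1 [l2 ->]].
    exists (fun t => Fn f (l1 ++ t :: l2)).
    split; [reflexivity|]; split; [intros P t u Htu; constructor; exact Htu|]; split.
    + intros t. apply Hs. constructor. apply in_elt.
    + intros Hw t Ht. inversion Hw as [| | | | | | |f' l' Hlen Hall]; subst. constructor.
      * rewrite length_app in *. exact Hlen.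
      * intros u Hu. apply in_mid in Hu. destruct Hu as [->|Hu]; [exact Ht|].
        apply Hall. apply in_mid. right. exact Hu.
  - exists (fun t => t). repeat split; auto.
    + intros P t u H; exact H.
    + intros t; apply rt_refl.
  - destruct IH1 as [c1 [<- [L1 [S1 W1]]]]. destruct IH2 as [c2 [<- [L2 [S2 W2]]]].
    exists (fun t => c2 (c1 t)). repeat split.
    + intros P t u H. apply L2, L1, H.
    + intros t. eapply rt_trans; [apply S1|apply S2].
    + intros Hw t Ht. apply W2; [exact Hw|]. apply W1; [|exact Ht].
      exact (wf_subterm (S2 _) Hw).
Qed.

Lemma equiv_approxE M N : equiv M N -> approxE M N.
Proof.
  induction 1; [apply rst_step; right; assumption|apply rst_refl|
    apply rst_sym; assumption|eapply rst_trans; eassumption].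
Qed.

Lemma rule_approxE M N : ctx_step (rule_inst RE) M N -> approxE M N.
Proof. intros. apply rst_step. left. assumption. Qed.

Lemma acEq_lift A c M N : liftable c -> acEq A M N -> acEq A (c M) (c N).
Proof.
  intros Hc. induction 1; [apply rst_step, Hc; assumption|apply rst_refl|
    apply rst_sym; assumption|eapply rst_trans; eassumption].
Qed.

Lemma approxE_lift c M N : liftable c -> approxE M N -> approxE (c M) (c N).
Proof.
  intros Hc. induction 1 as [M N [H|H]| | |]; [apply rst_step; left; apply Hc; assumption|
    apply rst_step; right; apply Hc; assumption|apply rst_refl|
    apply rst_sym; assumption|eapply rst_trans; eassumption].
Qed.

Lemma rstep_lift R A c M N : liftable c -> rstep R A M N -> rstep R A (c M) (c N).
Proof.
  intros Hc [M' [N' [H1 [H2 H3]]]]. exists (c M'), (c N').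
  auto using acEq_lift.
Qed.

Lemma Fn_mid_liftable f l1 l2 : liftable (fun t : tm => Fn f (l1 ++ t :: l2)).
Proof. intros P t u H. apply cs_fn. exact H. Qed.

Lemma approxE_Fn f l l' : Forall2 approxE l l' -> approxE (Fn f l) (Fn f l').
Proof.
  intros H. change (approxE (Fn f ([] ++ l)) (Fn f ([] ++ l'))). generalize (@nil tm).
  induction H as [|a b l l' Hab _ IH]; intros p; [apply rst_refl|].
  eapply rst_trans with (Fn f (p ++ b :: l)).
  - apply (approxE_lift (Fn_mid_liftable f p l) Hab).
  - specialize (IH (p ++ [b])). rewrite <- !app_assoc in IH. exact IH.
Qed.

Lemma nf_subterm N M : subterm N M -> nf M -> nf N.
Proof.
  intros Hs [Hw Hn]. split; [eapply wf_subterm; eassumption|].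
  intros [N' HN]. destruct (subterm_ctx Hs) as [c [<- [Hc _]]].
  apply Hn. exists (c N'). apply rstep_lift; assumption.
Qed.

Lemma rstep_equiv_l M M' N : equiv M M' -> rstepE M' N -> rstepE M N.
Proof.
  intros H [M1 [N1 [H1 H2]]]. exists M1, N1. split; [|exact H2].
  eapply rst_trans; eassumption.
Qed.

(** Constructors are free modulo AC, so their arguments can be compared one by one. Under [Fn] only
    the symbol is kept, since AC may regroup and permute the arguments. *)
Definition same_shape M N : Prop :=
  match M, N with
  | Name a, Name b | Var a, Var b => a = b
  | Pub A, Pub A' => equiv A A'
  | Sign A B, Sign A' B' | Blind A B, Blind A' B'
  | Pair A B, Pair A' B' | Enc A B, Enc A' B' => equiv A A' /\ equiv B B'
  | Fn f _, Fn g _ => f = g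
  | _, _ => False
  end.

Lemma equiv_same_shape M N : equiv M N -> same_shape M N.
Proof.
  induction 1 as [M N H|M|M N _ IH|M N O _ IH1 _ IH2].
  - destruct H as [M N [f [x [y [z [_ [[-> ->]|[-> ->]]]]]]]| | | | | | | | | |]; simpl;
      try split; try reflexivity; try apply rst_refl; apply rst_step; assumption.
  - destruct M; simpl; try split; try reflexivity; apply rst_refl.
  - destruct M, N; simpl in *; try contradiction; try (destruct IH; split);
      try (symmetry; assumption); apply rst_sym; assumption.
  - destruct M, N; simpl in *; try contradiction; destruct O; simpl in *; try contradiction;
      try (destruct IH1, IH2; split); try congruence; eapply rst_trans; eassumption.
Qed.

(** * Aliens and their abstraction *)

Definition headed i t : bool :=
  match t with Fn f _ => Nat.eqb (thy T f) i | _ => false end.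

Lemma headed_equiv i M N : equiv M N -> headed i M = headed i N.
Proof.
  intros H. apply equiv_same_shape in H.
  destruct M, N; simpl in *; try contradiction; subst; reflexivity.
Qed.

Inductive alien i : tm -> tm -> Prop :=
| alien_self t : headed i t = false -> alien i t t
| alien_arg e t f l : thy T f = i -> In t l -> alien i e t -> alien i e (Fn f l).

Lemma alien_headed i e t : alien i e t -> headed i e = false.
Proof. induction 1; assumption. Qed.

Lemma alien_subterm i e t : alien i e t -> subterm e t.
Proof.
  induction 1; [apply rt_refl|]. eapply rt_trans; [eassumption|].
  apply rt_step. constructor. assumption.
Qed.

Lemma alien_not_headed i e t : headed i t = false -> alien i e t -> e = t.
Proof.
  intros Ht H. destruct H as [|e t f l Hf]; [reflexivity|].
  simpl in Ht. subst i. rewrite Nat.eqb_refl in Ht. discriminate.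
Qed.

Lemma alien_Fn i e f l : thy T f = i ->
  (alien i e (Fn f l) <-> exists t, In t l /\ alien i e t).
Proof.
  intros Hf. split.
  - intros H. inversion H as [u Hu|e' t f' l' Hf' Hin Ht]; subst.
    + simpl in Hu. rewrite Nat.eqb_refl in Hu. discriminate.
    + eauto.
  - intros [t [Hin Ht]]. econstructor; eassumption.
Qed.

Lemma alien_Fn2 i e f x y : thy T f = i ->
  (alien i e (Fn f [x; y]) <-> alien i e x \/ alien i e y).
Proof.
  intros Hf. rewrite alien_Fn by exact Hf. simpl. split.
  - intros [t [[<-|[<-|[]]] He]]; auto.
  - intros [He|He]; eauto.
Qed.

(** The side conditions of [gs] and [cs], merged. *)
Definition analytic N M : Prop := guarded N /\ subterm N M \/ cross_sub N M.

Lemma cross_sub_subterm N M : cross_sub N M -> subterm N M.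
Proof.
  intros [g [l [f [l' [H [Hin _]]]]]]. eapply rt_trans; [|exact H].
  apply rt_step. constructor. exact Hin.
Qed.

Lemma analytic_subterm N M M' : analytic N M -> subterm M M' -> analytic N M'.
Proof.
  intros [[Hg Hs]|[g [l [f [l' [Hs H]]]]]] HM.
  - left. split; [exact Hg|]. eapply rt_trans; eassumption.
  - right. exists g, l, f, l'. split; [|exact H]. eapply rt_trans; eassumption.
Qed.

(** An alien found strictly below the root is an immediate argument of a symbol of theory [i]. It is
    either guarded or headed in another theory, hence a cross-theory subterm. *)
Lemma alien_analytic i e t : alien i e t -> headed i t = true -> analytic e t.
Proof.
  induction 1 as [t Ht|e t f l Hf Hin He IH]; intros Hh; [congruence|].
  destruct (headed i t) eqn:Ht.
  - eapply analytic_subterm; [apply IH; reflexivity|]. apply rt_step. constructor. exact Hin.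
  - apply (alien_not_headed Ht) in He. subst e.
    destruct t as [| | | | | | |g l'];
      try (left; split; [exact I|apply rt_step; constructor; exact Hin]).
    right. exists f, l, g, l'. split; [apply rt_refl|]. split; [exact Hin|].
    split; [reflexivity|]. simpl in Ht. apply Nat.eqb_neq in Ht. congruence.
Qed.

(** A step inside the [i]-layer only moves aliens around; any other step happens inside one alien
    and replaces it by an equivalent one. Both directions are kept together for the symmetry case of
    [alien_equiv]. *)
Lemma alien_ac_step i M N : ctx_step (ac_ax (isAC T)) M N ->
  (forall e, alien i e M -> exists e', alien i e' N /\ equiv e e') /\
  (forall e, alien i e N -> exists e', alien i e' M /\ equiv e e').
Proof.
  intros H.
  assert (Hq : equiv M N) by (apply rst_step; exact H).
  destruct (headed i M) eqn:HM.
  2:{ assert (HN := HM). rewrite (headed_equiv i Hq) in HN. split; intros e He.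
      - apply (alien_not_headed HM) in He. subst. exists N. split; [constructor|]; assumption.
      - apply (alien_not_headed HN) in He. subst. exists M. split; [constructor; assumption|].
        apply rst_sym; assumption. }
  clear Hq. revert HM.
  induction H as [M N [f [x [y [z [_ [[-> ->]|[-> ->]]]]]]]| | | | | | | | | |f l1 l2 M N HMN IH];
    intros Hf; simpl in Hf; try discriminate; apply Nat.eqb_eq in Hf.
  - split; intros e He; exists e; (split; [|apply rst_refl]); revert He;
    rewrite !alien_Fn2 by exact Hf; tauto.
  - split; intros e He; exists e; (split; [|apply rst_refl]); revert He;
    rewrite !alien_Fn2 by exact Hf; tauto.
  - assert (Hq : equiv M N) by (apply rst_step; exact HMN).
    assert (IH' : (forall e, alien i e M -> exists e', alien i e' N /\ equiv e e') /\
                  (forall e, alien i e N -> exists e', alien i e' M /\ equiv e e')).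
    { destruct (headed i M) eqn:HM; [auto|].
      assert (HN := HM). rewrite (headed_equiv i Hq) in HN. split; intros e He.
      - apply (alien_not_headed HM) in He. subst. exists N. split; [constructor|]; assumption.
      - apply (alien_not_headed HN) in He. subst. exists M. split; [constructor; assumption|].
        apply rst_sym; assumption. }
    destruct IH' as [IH1 IH2].
    split; intros e He; apply alien_Fn in He; try exact Hf; destruct He as [t [Hin He]];
    apply in_mid in Hin; destruct Hin as [->|Hin].
    + destruct (IH1 e He) as [e' [He' Hee]]. exists e'. split; [|exact Hee].
      apply alien_Fn; [exact Hf|]. eauto using in_elt.
    + exists e. split; [|apply rst_refl]. apply alien_Fn; [exact Hf|].
      exists t. rewrite in_mid. auto.
    + destruct (IH2 e He) as [e' [He' Hee]]. exists e'. split; [|exact Hee].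
      apply alien_Fn; [exact Hf|]. eauto using in_elt.
    + exists e. split; [|apply rst_refl]. apply alien_Fn; [exact Hf|].
      exists t. rewrite in_mid. auto.
Qed.

Lemma alien_equiv i M N : equiv M N ->
  forall e, alien i e M -> exists e', alien i e' N /\ equiv e e'.
Proof.
  intros H. enough ((forall e, alien i e M -> exists e', alien i e' N /\ equiv e e') /\
    (forall e, alien i e N -> exists e', alien i e' M /\ equiv e e')) by tauto.
  induction H as [M N H|M|M N _ IH|M N O _ IH1 _ IH2].
  - apply alien_ac_step. exact H.
  - split; intros e He; exists e; (split; [exact He|apply rst_refl]).
  - tauto.
  - destruct IH1 as [A1 B1], IH2 as [A2 B2]. split; intros e He.
    + destruct (A1 e He) as [e1 [H1 E1]]. destruct (A2 e1 H1) as [e2 [H2 E2]].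
      exists e2. split; [exact H2|]. eapply rst_trans; eassumption.
    + destruct (B2 e He) as [e1 [H1 E1]]. destruct (B1 e1 H1) as [e2 [H2 E2]].
      exists e2. split; [exact H2|]. eapply rst_trans; eassumption.
Qed.

(** Abstraction of aliens. They are sent through an arbitrary [r] instead of to fresh variables, so
    that their images can be chosen in the context of a sequent. *)
Fixpoint abstract i (r : tm -> tm) t : tm :=
  match t with
  | Fn f l => if Nat.eqb (thy T f) i then Fn f (map (abstract i r) l) else r t
  | _ => r t
  end.

Lemma abstract_not_headed i r t : headed i t = false -> abstract i r t = r t.
Proof. destruct t; simpl; try reflexivity. intros ->. reflexivity. Qed.

Lemma abstract_Fn i r f l : thy T f = i ->
  abstract i r (Fn f l) = Fn f (map (abstract i r) l).
Proof. intros <-. simpl. rewrite Nat.eqb_refl. reflexivity. Qed.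

Lemma abstract_id i r t : (forall e, alien i e t -> r e = e) -> abstract i r t = t.
Proof.
  induction t as [| | | | | | |f l IH] using term_list_ind; intros H;
    try (simpl; apply H; constructor; reflexivity).
  destruct (headed i (Fn f l)) eqn:Hh.
  - simpl in Hh. apply Nat.eqb_eq in Hh. rewrite abstract_Fn by exact Hh. f_equal.
    rewrite <- (map_id l) at 2. apply map_ext_in. intros t Ht. apply IH; [exact Ht|].
    intros e He. apply H. econstructor; eassumption.
  - rewrite abstract_not_headed by exact Hh. apply H. constructor. exact Hh.
Qed.

(** Controls AC steps inside an alien, which change the argument of [r]. Images need only agree
    modulo [E], because abstracted terms are compared by [approxE]. *)
Definition respects_equiv (r : tm -> tm) : Prop :=
  forall M N, equiv M N -> approxE (r M) (r N).

Lemma abstract_ac_step i r M N : respects_equiv r ->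
  ctx_step (ac_ax (isAC T)) M N -> approxE (abstract i r M) (abstract i r N).
Proof.
  intros Hr H. assert (Hq : equiv M N) by (apply rst_step; exact H).
  induction H as [M N Hax| | | | | | | | | |f l1 l2 M N HMN IH]; simpl; auto.
  - destruct (headed i M) eqn:HM.
    2:{ rewrite !abstract_not_headed; auto. rewrite <- (headed_equiv i Hq). exact HM. }
    destruct Hax as [f [x [y [z [Hf HH]]]]].
    apply rst_step. right. constructor.
    exists f, (abstract i r x), (abstract i r y), (abstract i r z). split; [exact Hf|].
    destruct HH as [[-> ->]|[-> ->]]; simpl in *; rewrite HM; auto.
  - destruct (Nat.eqb (thy T f) i) eqn:Hf.
    + rewrite !map_app. simpl. apply (approxE_lift (Fn_mid_liftable f _ _)).
      apply IH. apply rst_step. exact HMN.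
    + apply Hr. exact Hq.
Qed.

Lemma abstract_equiv i r M N : respects_equiv r ->
  equiv M N -> approxE (abstract i r M) (abstract i r N).
Proof.
  intros Hr. induction 1; [apply abstract_ac_step; assumption|apply rst_refl|
    apply rst_sym; assumption|eapply rst_trans; eassumption].
Qed.

(** A pure term contributes only to the [i]-layer, so abstraction passes to the substitution. Hence
    an abstracted instance of a rule is again an instance of that rule. *)
Lemma abstract_subst i r s t : pure i t ->
  abstract i r (subst s t) = subst (fun x => abstract i r (s x)) t.
Proof.
  induction t as [| | | | | | |f l IH] using term_list_ind; intros Hp;
    inversion Hp as [|f' l' Hf Hl]; subst; [reflexivity|].
  simpl subst. rewrite abstract_Fn by reflexivity. rewrite map_map. f_equal.
  apply map_ext_in. auto.
Qed.

(** With the converse [alien_subst] and with [RE_vars], this shows that applying a rule of theory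
    [i] creates no new alien. *)
Lemma alien_subst_inv i e s t : pure i t -> alien i e (subst s t) ->
  exists x, subterm (Var x) t /\ alien i e (s x).
Proof.
  induction t as [|x| | | | | |f l IH] using term_list_ind; intros Hp He;
    inversion Hp as [|f' l' Hf Hl]; subst; simpl in He.
  - exists x. split; [apply rt_refl|exact He].
  - apply alien_Fn in He; [|reflexivity]. destruct He as [u [Hu He]].
    apply in_map_iff in Hu. destruct Hu as [t [<- Ht]].
    destruct (IH t Ht (Hl t Ht) He) as [x [Hx Hex]]. exists x. split; [|exact Hex].
    eapply rt_trans; [exact Hx|]. apply rt_step. constructor. exact Ht.
Qed.

Lemma subterm_inv N M : subterm N M -> N = M \/ exists M', imm_sub M' M /\ subterm N M'.
Proof.
  intros H. apply clos_rt_rtn1 in H. inversion H as [|M' M0 H1 H2]; subst; [left; reflexivity|].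
  right. exists M'. split; [exact H1|]. apply clos_rtn1_rt. exact H2.
Qed.

Lemma alien_subst i e s t x : pure i t -> subterm (Var x) t ->
  alien i e (s x) -> alien i e (subst s t).
Proof.
  induction t as [|y| | | | | |f l IH] using term_list_ind; intros Hp Hx He;
    inversion Hp as [|f' l' Hf Hl]; subst; simpl;
    apply subterm_inv in Hx; destruct Hx as [Hx|[M [HM Hx]]];
    try discriminate; try (inversion HM; fail).
  - injection Hx as ->. exact He.
  - inversion HM; subst. apply alien_Fn; [reflexivity|]. exists (subst s M).
    split; [apply in_map; assumption|]. auto.
Qed.

Lemma wf_subst s t : wf t -> (forall x, wf (s x)) -> wf (subst s t).
Proof.
  intros Ht Hs. induction Ht as [| | | | | | |f l Hlen _ IH]; simpl; try (constructor; assumption); auto.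
  constructor; [rewrite length_map; exact Hlen|].
  intros t Ht. apply in_map_iff in Ht. destruct Ht as [u [<- Hu]]. auto.
Qed.

Lemma subst_not_in s x t : (forall y, y <> x -> s y = Var y) ->
  ~ subterm (Var x) t -> subst s t = t.
Proof.
  intros Hs. induction t as [|y|M IH|M N IH1 IH2|M N IH1 IH2|M N IH1 IH2|M N IH1 IH2|f l IH]
    using term_list_ind; intros Hx; simpl.
  - reflexivity.
  - apply Hs. intros ->. apply Hx. apply rt_refl.
  - rewrite IH; [reflexivity|]. intros H. apply Hx. eapply rt_trans; [exact H|apply rt_step; constructor].
  - rewrite IH1, IH2; [reflexivity| |]; intros H; apply Hx;
      (eapply rt_trans; [exact H|apply rt_step; constructor]).
  - rewrite IH1, IH2; [reflexivity| |]; intros H; apply Hx;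
      (eapply rt_trans; [exact H|apply rt_step; constructor]).
  - rewrite IH1, IH2; [reflexivity| |]; intros H; apply Hx;
      (eapply rt_trans; [exact H|apply rt_step; constructor]).
  - rewrite IH1, IH2; [reflexivity| |]; intros H; apply Hx;
      (eapply rt_trans; [exact H|apply rt_step; constructor]).
  - f_equal. rewrite <- (map_id l) at 2. apply map_ext_in. intros t Ht. apply IH; [exact Ht|].
    intros H. apply Hx. eapply rt_trans; [exact H|apply rt_step; constructor; exact Ht].
Qed.

Lemma subterm_subst s N M : subterm N M -> subterm (subst s N) (subst s M).
Proof.
  induction 1 as [N M H| |]; [|apply rt_refl|eapply rt_trans; eassumption].
  apply rt_step. destruct H; simpl; constructor. apply in_map. assumption.
Qed.

(** * Rewriting terms whose aliens are normal *)

Hypothesis V : valid_theory T.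

Lemma RE_valid a b : RE a b -> exists i, pure i a /\ pure i b /\ wf a /\ wf b.
Proof.
  intros [i [_ H]]. destruct V as [_ [_ [_ [HR _]]]].
  exists i. apply (HR _ _ _ H).
Qed.

Lemma rstepE_rule a b s : RE a b -> rstepE (subst s a) (subst s b).
Proof.
  intros H. exists (subst s a), (subst s b). repeat split; try apply rst_refl.
  constructor. exists a, b, s. auto.
Qed.

(* A rule [x -> b] would apply to every term, for ever. *)
Lemma RE_lhs_not_var x b : ~ RE (Var x) b.
Proof.
  intros H. destruct (RE_valid H) as [i [_ [_ [_ Hb]]]].
  destruct V as [_ [_ [_ [_ [_ [Hterm _]]]]]].
  assert (Hw : wf (@Name (sym T) 0)) by constructor.
  specialize (Hterm _ Hw). revert Hw.
  induction Hterm as [M _ IH]. intros Hw.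
  apply (IH (subst (fun _ => M) b)).
  - split; [exact Hw|]. exact (rstepE_rule (fun _ => M) H).
  - apply wf_subst; auto.
Qed.

(* Otherwise [a] would rewrite to a term containing [a], by instantiating [x] with [a]. *)
Lemma RE_vars a b x : RE a b -> subterm (Var x) b -> subterm (Var x) a.
Proof.
  intros H Hx. apply NNPP. intros Hn.
  destruct (RE_valid H) as [i [_ [_ [Ha Hb]]]].
  destruct V as [_ [_ [_ [_ [_ [Hterm _]]]]]].
  set (s := fun y => if Nat.eqb y x then a else Var y).
  assert (Hsa : subst s a = a).
  { apply subst_not_in with x; [|exact Hn]. intros y Hy. unfold s.
    apply Nat.eqb_neq in Hy. rewrite Hy. reflexivity. }
  assert (Hsb : subterm a (subst s b)).
  { replace a with (subst s (Var x)); [apply subterm_subst; exact Hx|].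
    simpl. unfold s. rewrite Nat.eqb_refl. reflexivity. }
  assert (Hwb : wf (subst s b)).
  { apply wf_subst; [exact Hb|]. intros y. unfold s.
    destruct (Nat.eqb y x); [exact Ha|constructor]. }
  assert (Hstep := rstepE_rule s H). rewrite Hsa in Hstep.
  assert (Hall : forall M, wf M -> subterm a M -> False); [|apply (Hall a Ha); apply rt_refl].
  intros M Hw. generalize Hw. generalize (Hterm _ Hw). clear Hw.
  induction 1 as [M _ IH]. intros Hw Hs.
  destruct (subterm_ctx Hs) as [c [<- [Hc [Hsc Hwc]]]].
  apply (IH (c (subst s b))).
  - split; [exact Hw|]. apply rstep_lift; assumption.
  - auto.
  - eapply rt_trans; [exact Hsb|]. apply Hsc.
Qed.

(** No rule applies inside an alien, as it is equivalent to a normal term. The redex is therefore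
    headed in theory [i], and so is the left-hand side of the rule, which is not a variable; the
    rule is pure in [i] and commutes with abstraction. The parameter [B] records where aliens come
    from. *)
Lemma alien_rule_step i (B : tm -> Prop) r u v :
  respects_equiv r -> (forall e, B e -> nf e) ->
  (forall e, alien i e u -> exists e', B e' /\ equiv e e') ->
  ctx_step (rule_inst RE) u v ->
  (forall e, alien i e v -> exists e', B e' /\ equiv e e') /\
  approxE (abstract i r u) (abstract i r v).
Proof.
  intros Hr HB Hu H.
  (* Otherwise [u] is its own alien and, being equivalent to a normal term, cannot be rewritten. *)
  assert (Hnf : headed i u = false -> False).
  { intros Hh. destruct (Hu u) as [e' [HB' He']]; [constructor; exact Hh|].
    destruct (HB e' HB') as [_ Hirr]. apply Hirr. exists v.
    exists u, v. split; [apply rst_sym; exact He'|]. split; [exact H|apply rst_refl]. }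
  induction H as [u v [a [b [s [HR [-> ->]]]]]| | | | | | | | | |f l1 l2 u v HS IH];
    try (exfalso; apply Hnf; reflexivity).
  - destruct (RE_valid HR) as [j [Pa [Pb _]]].
    destruct Pa as [x|f l Hf Hl]; [exfalso; apply (RE_lhs_not_var HR)|].
    destruct (headed i (subst s (Fn f l))) eqn:Hh; [|contradiction (Hnf eq_refl)].
    simpl in Hh. apply Nat.eqb_eq in Hh. assert (j = i) as -> by congruence.
    assert (Pa : pure i (Fn f l)) by (constructor; assumption).
    split.
    + intros e He. apply alien_subst_inv in He; [|exact Pb]. destruct He as [x [Hx He]].
      apply Hu. apply alien_subst with x; auto. apply (RE_vars HR Hx).
    + rewrite !abstract_subst by assumption. apply rule_approxE. constructor.
      exists (Fn f l), b, (fun x => abstract i r (s x)). auto.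
  - destruct (headed i (Fn f (l1 ++ u :: l2))) eqn:Hh; [|contradiction (Hnf eq_refl)].
    simpl in Hh. apply Nat.eqb_eq in Hh.
    assert (Hu' : forall e, alien i e u -> exists e', B e' /\ equiv e e').
    { intros e He. apply Hu. apply alien_Fn; [exact Hh|]. eauto using in_elt. }
    destruct IH as [IH1 IH2]; [exact Hu'| |].
    { intros Hhu. destruct (Hu' u) as [e' [HB' He']]; [constructor; exact Hhu|].
      destruct (HB e' HB') as [_ Hirr]. apply Hirr. exists v.
      exists u, v. split; [apply rst_sym; exact He'|]. split; [exact HS|apply rst_refl]. }
    split.
    + intros e He. apply alien_Fn in He; [|exact Hh]. destruct He as [t [Hin He]].
      apply in_mid in Hin. destruct Hin as [->|Hin]; [auto|].
      apply Hu. apply alien_Fn; [exact Hh|]. exists t. rewrite in_mid. auto.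
    + rewrite !abstract_Fn by exact Hh. rewrite !map_app. simpl.
      apply (approxE_lift (Fn_mid_liftable f _ _)). exact IH2.
Qed.

Lemma alien_rsteps i (B : tm -> Prop) r u v :
  respects_equiv r -> (forall e, B e -> nf e) ->
  clos_refl_trans tm rstepE u v ->
  (forall e, alien i e u -> exists e', B e' /\ equiv e e') ->
  (forall e, alien i e v -> exists e', B e' /\ equiv e e') /\
  approxE (abstract i r u) (abstract i r v).
Proof.
  intros Hr HB. induction 1 as [u v [u' [v' [H1 [H2 H3]]]]|u|u v w _ IH1 _ IH2]; intros Hu.
  - assert (Heq : forall a b, equiv a b ->
      (forall e, alien i e a -> exists e', B e' /\ equiv e e') ->
      forall e, alien i e b -> exists e', B e' /\ equiv e e').
    { intros a b Hab Ha e He. apply rst_sym in Hab.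
      destruct (alien_equiv Hab He) as [e1 [He1 E1]].
      destruct (Ha e1 He1) as [e2 [He2 E2]]. exists e2. split; [exact He2|].
      eapply rst_trans; eassumption. }
    destruct (alien_rule_step B Hr HB (Heq u u' H1 Hu) H2) as [H4 H5].
    split; [exact (Heq v' v H3 H4)|].
    eapply rst_trans; [apply (abstract_equiv i Hr H1)|].
    eapply rst_trans; [exact H5|]. apply (abstract_equiv i Hr H3).
  - split; [exact Hu|apply rst_refl].
  - destruct (IH1 Hu) as [Hv E1]. destruct (IH2 Hv) as [Hw E2].
    split; [exact Hw|]. eapply rst_trans; eassumption.
Qed.

(** * Confluence on well-formed terms *)

(** An [approxE]-chain between well-formed terms may pass through ill-formed ones;
    [tidy] maps it to a chain of well-formed terms. *)
Fixpoint tidy t : tm :=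
  match t with
  | Name a => Name a
  | Var x => Var x
  | Pub M => Pub (tidy M)
  | Sign M N => Sign (tidy M) (tidy N)
  | Blind M N => Blind (tidy M) (tidy N)
  | Pair M N => Pair (tidy M) (tidy N)
  | Enc M N => Enc (tidy M) (tidy N)
  | Fn f l => if Nat.eqb (length l) (arity T f) then Fn f (map tidy l) else Name 0
  end.

Lemma tidy_wf t : wf (tidy t).
Proof.
  induction t as [| | | | | | |f l IH] using term_list_ind; simpl; try (constructor; assumption).
  destruct (Nat.eqb (length l) (arity T f)) eqn:Hl; [|constructor].
  apply Nat.eqb_eq in Hl. constructor; [rewrite length_map; exact Hl|].
  intros t Ht. apply in_map_iff in Ht. destruct Ht as [u [<- Hu]]. auto.
Qed.

Lemma tidy_subst s t : wf t -> tidy (subst s t) = subst (fun x => tidy (s x)) t.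
Proof.
  induction 1 as [| |M _ IH|M N _ IH1 _ IH2|M N _ IH1 _ IH2|M N _ IH1 _ IH2|M N _ IH1 _ IH2
    |f l Hl _ IH]; simpl; try congruence.
  rewrite length_map, Hl, Nat.eqb_refl, map_map. f_equal. apply map_ext_in. exact IH.
Qed.

Lemma tidy_id t : wf t -> tidy t = t.
Proof.
  induction 1 as [| |M _ IH|M N _ IH1 _ IH2|M N _ IH1 _ IH2|M N _ IH1 _ IH2|M N _ IH1 _ IH2
    |f l Hl _ IH]; simpl; try congruence.
  rewrite Hl, Nat.eqb_refl. f_equal. rewrite <- (map_id l) at 2. apply map_ext_in. exact IH.
Qed.

(** A step disappears when it lies below a symbol with the wrong number of arguments, because [tidy]
    collapses both sides to the same name. *)
Lemma tidy_step (P : tm -> tm -> Prop) M N :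
  (forall a b, P a b -> P (tidy a) (tidy b)) ->
  ctx_step P M N -> tidy M = tidy N \/ ctx_step P (tidy M) (tidy N).
Proof.
  intros HP. induction 1; simpl; try (destruct IHctx_step as [->|IH]; [left; reflexivity|
    right; constructor; exact IH]).
  - right. constructor. auto.
  - rewrite !length_app. simpl.
    destruct (Nat.eqb (length l1 + Datatypes.S (length l2)) (arity T f)); [|left; reflexivity].
    rewrite !map_app. simpl. destruct IHctx_step as [->|IH]; [left; reflexivity|].
    right. apply cs_fn. exact IH.
Qed.

Definition joinable M N : Prop := exists P Q,
  clos_refl_trans tm rstepE M P /\ clos_refl_trans tm rstepE N Q /\ equiv P Q.

(** A first rewrite step absorbs the AC conversion; only the empty sequence leaves it over, whence
    the [equiv] in the conclusion. *)
Lemma rsteps_equiv_l M M' N : equiv M M' -> clos_refl_trans tm rstepE M' N ->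
  exists N', clos_refl_trans tm rstepE M N' /\ equiv N' N.
Proof.
  intros HM H. apply clos_rt_rt1n in H. destruct H as [|M1 N H1 H2].
  - exists M. split; [apply rt_refl|exact HM].
  - exists N. split; [|apply rst_refl]. apply clos_rt1n_rt in H2.
    eapply rt_trans; [|exact H2]. apply rt_step. apply (rstep_equiv_l HM H1).
Qed.

(** Confluence is applied at the middle term, the only one that has to be well-formed. *)
Lemma joinable_trans M N O : wf N -> joinable M N -> joinable N O -> joinable M O.
Proof.
  intros Hw [P1 [P2 [H1 [H2 H3]]]] [Q1 [Q2 [H4 [H5 H6]]]].
  destruct V as [_ [_ [_ [_ [_ [_ Hconf]]]]]].
  destruct (Hconf _ _ _ Hw H2 H4) as [R1 [R2 [H7 [H8 H9]]]].
  destruct (rsteps_equiv_l H3 H7) as [R1' [H10 H11]].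
  apply rst_sym in H6. destruct (rsteps_equiv_l H6 H8) as [R2' [H12 H13]].
  exists R1', R2'. repeat split.
  - eapply rt_trans; eassumption.
  - eapply rt_trans; eassumption.
  - eapply rst_trans; [exact H11|]. eapply rst_trans; [exact H9|].
    apply rst_sym. exact H13.
Qed.

Lemma approxE_joinable M N : wf M -> wf N -> approxE M N -> joinable M N.
Proof.
  intros HM HN H. rewrite <- (tidy_id HM), <- (tidy_id HN). clear HM HN.
  assert (Hrefl : forall M, joinable M M).
  { intros t. exists t, t. repeat split; try apply rt_refl. apply rst_refl. }
  induction H as [M N [H|H]|M|M N _ [P [Q [H1 [H2 H3]]]]|M N O _ IH1 _ IH2].
  - apply tidy_step in H; [destruct H as [->|H]; [auto|]|].
    + exists (tidy N), (tidy N). repeat split; [|apply rt_refl|apply rst_refl].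
      apply rt_step. exists (tidy M), (tidy N). repeat split; try apply rst_refl. exact H.
    + intros a b [x [y [s [HR [-> ->]]]]].
      destruct (RE_valid HR) as [i [_ [_ [Hx Hy]]]].
      rewrite !tidy_subst by assumption. exists x, y, (fun x => tidy (s x)). auto.
  - apply tidy_step in H; [destruct H as [->|H]; [auto|]|].
    + exists (tidy M), (tidy N). repeat split; try apply rt_refl.
      apply rst_step. exact H.
    + intros a b [f [x [y [z [Hf HH]]]]]. exists f, (tidy x), (tidy y), (tidy z).
      split; [exact Hf|]. destruct V as [_ [Har _]].
      destruct HH as [[-> ->]|[-> ->]]; simpl; rewrite (Har f Hf); simpl; auto.
  - apply Hrefl.
  - exists Q, P. repeat split; auto. apply rst_sym. exact H3.
  - eapply joinable_trans; [|exact IH1|exact IH2]. apply tidy_wf.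
Qed.

(* Rewriting a term whose aliens are normal acts only on its [i]-layer, with rules of theory [i]. *)
Lemma abstraction i (B : tm -> Prop) r u t :
  respects_equiv r -> (forall e, B e -> nf e) ->
  (forall e, alien i e u -> exists e', B e' /\ equiv e e') ->
  wf u -> nf t -> approxE t u ->
  (forall e, alien i e t -> exists e', B e' /\ equiv e e') /\
  approxE (abstract i r t) (abstract i r u).
Proof.
  intros Hr HB Hu Hwu [Hwt Ht] Htu.
  destruct (approxE_joinable Hwt Hwu Htu) as [P [Q [HP [HQ HPQ]]]].
  (* A normal [t] has no proper reduct, so all the rewriting starts from [u]. *)
  assert (P = t) as ->.
  { apply clos_rt_rt1n in HP. destruct HP as [|P P' HP _]; [reflexivity|].
    exfalso. apply Ht. eauto. }
  destruct (alien_rsteps B Hr HB HQ Hu) as [H1 H2]. split.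
  - intros e He. destruct (alien_equiv HPQ He) as [e1 [He1 E1]].
    destruct (H1 e1 He1) as [e2 [He2 E2]]. exists e2. split; [exact He2|].
    eapply rst_trans; eassumption.
  - eapply rst_trans; [apply (abstract_equiv i Hr HPQ)|]. apply rst_sym. exact H2.
Qed.

(** * Contexts whose holes satisfy a predicate *)

(** Generalises [ctx_inst], so that holes can be tracked by origin: members of [G], synthesised
    terms, aliens of the goal. *)
Inductive cinst i (P : tm -> Prop) : tm -> Prop :=
| cinst_hole e : P e -> cinst i P e
| cinst_fn f l : thy T f = i -> length l = arity T f ->
    (forall t, In t l -> cinst i P t) -> cinst i P (Fn f l).

Lemma cinst_ctx_inst i G C : cinst i (fun e => In e G) C <-> ctx_inst i G C.
Proof. split; induction 1; try (constructor; assumption). Qed.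

Lemma cinst_mono i (P Q : tm -> Prop) C :
  (forall e, P e -> Q e) -> cinst i P C -> cinst i Q C.
Proof. intros H. induction 1; [apply cinst_hole|apply cinst_fn]; auto. Qed.

(** Refills the holes while the layer stays fixed. It is applied with [h] the identity, which grafts
    contexts into contexts, and with [h] an abstraction. *)
Lemma cinst_map i (P Q : tm -> Prop) h C :
  (forall f l, thy T f = i -> h (Fn f l) = Fn f (map h l)) ->
  (forall e, P e -> exists C', cinst i Q C' /\ approxE (h e) C') ->
  cinst i P C -> exists C', cinst i Q C' /\ approxE (h C) C'.
Proof.
  intros Hh HP. induction 1 as [e He|f l Hf Hl _ IH]; [auto|].
  apply list_choice in IH. destruct IH as [l' Hl'].
  exists (Fn f l'). split.
  - constructor; [exact Hf| |].
    + rewrite <- Hl. symmetry. eapply Forall2_length. exact Hl'.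
    + intros t Ht. destruct (Forall2_in_r _ Hl' Ht) as [u [_ [Hu _]]]. exact Hu.
  - rewrite Hh by exact Hf. apply approxE_Fn.
    clear - Hl'. induction Hl' as [|t u l l' [_ H] _ IH]; simpl; constructor; assumption.
Qed.

Lemma cinst_bind i (P Q : tm -> Prop) C :
  (forall e, P e -> exists C', cinst i Q C' /\ approxE e C') ->
  cinst i P C -> exists C', cinst i Q C' /\ approxE C C'.
Proof.
  apply (cinst_map (fun t => t)). intros f l _. rewrite map_id. reflexivity.
Qed.

Lemma cinst_finite i (P R : tm -> Prop) C : cinst i (fun e => P e \/ R e) C ->
  exists L, (forall e, In e L -> P e) /\ cinst i (fun e => In e L \/ R e) C.
Proof.
  induction 1 as [e [He|He]|f l Hf Hl _ IH].
  - exists [e]. split; [intros ? [<-|[]]; exact He|]. constructor. simpl. auto.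
  - exists []. split; [intros ? []|]. constructor. auto.
  - apply list_choice in IH. destruct IH as [Ls HLs].
    exists (concat Ls). split.
    + intros e He. apply in_concat in He. destruct He as [L [HL He]].
      destruct (Forall2_in_r _ HLs HL) as [t [_ [HP _]]]. auto.
    + constructor; [exact Hf|exact Hl|]. intros t Ht.
      assert (exists L, In L Ls /\ cinst i (fun e => In e L \/ R e) t) as [L [HL Hc]].
      { clear - HLs Ht. induction HLs as [|u L l Ls [_ H] _ IH]; [destruct Ht|]; destruct Ht as [<-|Ht].
        - exists L. simpl. auto.
        - destruct (IH Ht) as [L' [? ?]]. exists L'. simpl. auto. }
      revert Hc. apply cinst_mono. intros e [He|He]; [left|right; exact He].
      apply in_concat. eauto.
Qed.

Lemma cinst_wf i (P : tm -> Prop) C : (forall e, P e -> wf e) -> cinst i P C -> wf C.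
Proof. intros H. induction 1; [auto|constructor; assumption]. Qed.

Lemma cinst_alien i (P : tm -> Prop) C : cinst i P C ->
  forall e, alien i e C -> exists p, P p /\ alien i e p.
Proof.
  induction 1 as [p Hp|f l Hf Hl _ IH]; intros e He; [eauto|].
  apply alien_Fn in He; [|exact Hf]. destruct He as [t [Ht He]]. eauto.
Qed.

Lemma cinst_aliens i t : wf t -> headed i t = true -> cinst i (fun e => alien i e t) t.
Proof.
  induction t as [| | | | | | |f l IH] using term_list_ind; intros Hw Hh;
    try discriminate.
  simpl in Hh. apply Nat.eqb_eq in Hh. inversion Hw as [| | | | | | |f' l' Hl Hwl]; subst f' l'.
  constructor; [exact Hh|exact Hl|]. intros t Ht.
  destruct (headed i t) eqn:Hht.
  - generalize (IH t Ht (Hwl t Ht) Hht). apply cinst_mono. intros e He.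
    apply alien_Fn; eauto.
  - constructor. apply alien_Fn; [exact Hh|]. exists t. split; [exact Ht|].
    constructor. exact Hht.
Qed.

(** * Basic properties of derivations, and weakening without cut *)

Lemma der_nf_seq b G M : der b G M -> nf_seq G M.
Proof. destruct 1; assumption. Qed.

Lemma der_nf b G M : der b G M -> nf M.
Proof. intros H. apply (der_nf_seq H). Qed.

(** Every derivation has an [id] leaf. This makes theory [0] available for applying [id] to a member
    of the context. *)
Lemma der_ntheories b G M : der b G M -> 0 < ntheories T.
Proof. induction 1; try assumption. lia. Qed.

Lemma der_weakening G M : der false G M ->
  forall G', incl G G' -> (forall t, In t G' -> nf t) -> der false G' M.
Proof.
  assert (Hc : forall G G' M, incl G G' -> incl (M :: G) (M :: G')).
  { intros G1 G2 N H. apply incl_cons; [left; reflexivity|]. apply incl_tl. exact H. }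
  assert (Hn : forall G G' M N, nf_seq (M :: G) N -> (forall t, In t G' -> nf t) ->
     forall t, In t (M :: G') -> nf t).
  { intros G1 G2 N N' [H _] HG' t [<-|Ht]; [apply H; left; reflexivity|auto]. }
  assert (Hn2 : forall G G' M M' N, nf_seq (M :: M' :: G) N -> (forall t, In t G' -> nf t) ->
     forall t, In t (M :: M' :: G') -> nf t).
  { intros G1 G2 N1 N2 N' [H _] HG' t [<-|[<-|Ht]]; [| |auto]; apply H; simpl; auto. }
  intros H. remember false as b eqn:Hb.
  induction H as [i G M C Hnf Hi HC E|G M N Hcut| G M N T0 Hnf Hin H1 IH1
    |G M N Hnf H1 IH1 H2 IH2|G M K N Hnf Hin H1 IH1 H2 IH2|G M K Hnf H1 IH1 H2 IH2
    |G M K L N Hnf Hin HinL HKL H1 IH1|G M K Hnf H1 IH1 H2 IH2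
    |G M K N Hnf Hin H1 IH1 H2 IH2|G M K Hnf H1 IH1 H2 IH2
    |G M R K N Hnf Hin H1 IH1 H2 IH2|G A M Hnf Hg [t [Ht Hs]] H1 IH1 H2 IH2
    |G N M Hnf [t [Ht Hs]] H1 IH1 H2 IH2]; intros G' HG HG';
    try (assert (Hnf' : nf_seq G' (snd (G, M))) by (split; [exact HG'|apply Hnf]));
    try (assert (Hnf' : nf_seq G' (snd (G, N))) by (split; [exact HG'|apply Hnf]));
    simpl in *; subst.
  - apply r_id with i C; auto. rewrite <- cinst_ctx_inst in *.
    revert HC. apply cinst_mono. exact HG.
  - discriminate.
  - apply r_pL with M N; auto; [split; [exact HG'|apply Hnf]|].
    apply IH1; auto. apply (Hn2 _ _ _ _ _ (der_nf_seq H1) HG').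
  - apply r_pR; auto. split; [exact HG'|apply Hnf].
  - apply r_eL with M K; auto. apply IH2; auto. apply (Hn2 _ _ _ _ _ (der_nf_seq H2) HG').
  - apply r_eR; auto. split; [exact HG'|apply Hnf].
  - apply r_signL with M K L; auto. apply IH1; auto. apply (Hn _ _ _ _ (der_nf_seq H1) HG').
  - apply r_signR; auto. split; [exact HG'|apply Hnf].
  - apply r_blindL1 with M K; auto. apply IH2; auto.
    apply (Hn2 _ _ _ _ _ (der_nf_seq H2) HG').
  - apply r_blindR; auto. split; [exact HG'|apply Hnf].
  - apply r_blindL2 with M R K; auto. apply IH2; auto.
    apply (Hn2 _ _ _ _ _ (der_nf_seq H2) HG').
  - apply r_gs with A; auto; [exists t; intuition|].
    apply IH2; auto. apply (Hn _ _ _ _ (der_nf_seq H2) HG').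
  - apply r_cs with N; auto; [exists t; intuition|].
    apply IH2; auto. apply (Hn _ _ _ _ (der_nf_seq H2) HG').
Qed.

(** * Saturated contexts *)

(** [part_unblind] accounts for [blindL2], whose new signature is not a subterm. *)
Inductive part : tm -> tm -> Prop :=
| part_imm_sub M N : imm_sub M N -> part M N
| part_unblind M R K : part (Sign M K) (Sign (Blind M R) K).

Definition parts : relation tm := clos_refl_trans tm part.

Lemma subterm_parts M N : subterm M N -> parts M N.
Proof.
  induction 1; [apply rt_step; constructor; assumption|apply rt_refl|
    eapply rt_trans; eassumption].
Qed.

Definition finite_parts t : Prop := exists L, forall s, parts s t -> In s L.

Lemma finite_parts_step t l : (forall s, part s t -> In s l) ->
  (forall s, In s l -> finite_parts s) -> finite_parts t.
Proof.
  intros Hl Hf. apply list_choice in Hf. destruct Hf as [Ls HLs].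
  exists (t :: concat Ls). intros s Hs. apply clos_rt_rtn1 in Hs.
  destruct Hs as [|u t Hu Hs]; [left; reflexivity|right].
  apply clos_rtn1_rt in Hs. specialize (Hl _ Hu). apply in_concat.
  clear - HLs Hs Hl. induction HLs as [|v L l Ls H _ IH]; [destruct Hl|]; destruct Hl as [<-|Hl].
  - exists L. simpl. auto.
  - destruct (IH Hl) as [L' [? ?]]. exists L'. simpl. auto.
Qed.

Lemma parts_finite t : finite_parts t.
Proof.
  assert (Hin2 : forall M N : tm, finite_parts M -> finite_parts N ->
    forall s, In s [M; N] -> finite_parts s).
  { intros M N HM HN s [<-|[<-|[]]]; assumption. }
  assert (Hsign : forall M, (forall A R, M <> Blind A R) -> finite_parts M ->
    forall K, finite_parts K -> finite_parts (Sign M K)).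
  { intros M HM FM K FK. apply finite_parts_step with [M; K]; [|apply Hin2; assumption].
    intros s Hs. inversion Hs as [? ? H|]; subst; [inversion H; subst; simpl; auto|].
    exfalso. eapply HM. reflexivity. }
  (* The parts of [Sign (Blind M R) K] include [Sign M K], which is not a subterm; the strengthened
     claim makes the induction hypothesis on [M] cover it. *)
  enough (finite_parts t /\ forall K, finite_parts K -> finite_parts (Sign t K)) by tauto.
  induction t as [a|x|M [FM _]|M N [FM SM] [FN _]|M N [FM SM] [FN _]|M N [FM _] [FN _]
    |M N [FM _] [FN _]|f l IH] using term_list_ind;
    match goal with
    | |- _ /\ (forall K, _ -> finite_parts (Sign (Blind _ _) K)) => idtac
    | |- ?A /\ _ => enough A by (split; [assumption|apply Hsign; [discriminate|assumption]])
    end.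
  - apply finite_parts_step with []; [|intros ? []].
    intros s Hs. inversion Hs as [? ? H|]; inversion H.
  - apply finite_parts_step with []; [|intros ? []].
    intros s Hs. inversion Hs as [? ? H|]; inversion H.
  - apply finite_parts_step with [M]; [|intros ? [<-|[]]; exact FM].
    intros s Hs. inversion Hs as [? ? H|]; subst; inversion H; subst; simpl; auto.
  - auto.
  - assert (FB : finite_parts (Blind M N)).
    { apply finite_parts_step with [M; N]; [|apply Hin2; assumption].
      intros s Hs. inversion Hs as [? ? H|]; subst; inversion H; subst; simpl; auto. }
    split; [exact FB|]. intros K FK.
    apply finite_parts_step with [Blind M N; K; Sign M K].
    + intros s Hs. inversion Hs as [? ? H|]; subst; [inversion H; subst|]; simpl; auto.
    + intros s [<-|[<-|[<-|[]]]]; auto.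
  - apply finite_parts_step with [M; N]; [|apply Hin2; assumption].
    intros s Hs. inversion Hs as [? ? H|]; subst; inversion H; subst; simpl; auto.
  - apply finite_parts_step with [M; N]; [|apply Hin2; assumption].
    intros s Hs. inversion Hs as [? ? H|]; subst; inversion H; subst; simpl; auto.
  - apply finite_parts_step with l; [|intros s Hs; apply (IH s Hs)].
    intros s Hs. inversion Hs as [? ? H|]; subst; inversion H; subst; assumption.
Qed.

(** The last clause asks only that the addition of [N] can be undone without cut, whatever rules
    achieve this. Thus [gs], [cs] and all left rules are treated uniformly. *)
Definition candidate G M N : Prop :=
  nf N /\ (exists t, (In t G \/ t = M) /\ parts N t) /\
  (der false (N :: G) M -> der false G M).

Definition saturated G M : Prop := forall N, candidate G M N -> In N G.

(** Candidates are added one at a time. The list [U] covers the parts not yet in the context and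
    loses an entry at each addition; it need not grow, since parts of parts are parts. *)
Lemma saturation M G : (forall t, In t G -> nf t) ->
  exists G', incl G G' /\ (forall t, In t G' -> nf t) /\ saturated G' M /\
    (der false G' M -> der false G M).
Proof.
  intros HG.
  assert (exists U, forall s t, In t G \/ t = M -> parts s t -> In s (U ++ G)) as [U HU].
  { assert (HF : forall t, In t (M :: G) -> finite_parts t) by (intros; apply parts_finite).
    apply list_choice in HF. destruct HF as [Ls HLs]. exists (concat Ls).
    intros s t Ht Hs. apply in_or_app. left. apply in_concat.
    assert (Ht' : In t (M :: G)) by (simpl; intuition).
    clear - HLs Hs Ht'. induction HLs as [|v L l Ls H _ IH]; [destruct Ht'|]; destruct Ht' as [<-|Ht'].
    - exists L. simpl. auto.
    - destruct (IH Ht') as [L' [? ?]]. exists L'. simpl. auto. }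
  remember (length U) as n eqn:Hn. revert U G HG HU Hn.
  induction n as [n IH] using lt_wf_ind. intros U G HG HU Hn.
  destruct (classic (saturated G M)) as [HS|HS].
  - exists G. split; [apply incl_refl|]. auto.
  - apply not_all_ex_not in HS. destruct HS as [N HS]. apply imply_to_and in HS.
    destruct HS as [[HN [[t [Ht Hp]] Hd]] Hnin].
    assert (HNU : In N U).
    { specialize (HU N t Ht Hp). apply in_app_or in HU. tauto. }
    apply in_split in HNU. destruct HNU as [l1 [l2 ->]].
    destruct (IH (length (l1 ++ l2))) with (U := l1 ++ l2) (G := N :: G)
      as [G' [H1 [H2 [H3 H4]]]].
    + rewrite Hn, !length_app. simpl. lia.
    + intros u [<-|Hu]; auto.
    + intros s u Hu Hs.
      assert (HsU : In s ((l1 ++ N :: l2) ++ G)).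
      { destruct Hu as [[<-|Hu]|Hu]; [|eauto|eauto].
        apply (HU s t Ht). eapply rt_trans; eassumption. }
      rewrite !in_app_iff in *. simpl in *. tauto.
    + reflexivity.
    + exists G'. split; [intros u Hu; apply H1; right; exact Hu|]. auto.
Qed.

(** * Synthesised terms *)

(** In [synth_fn] the aliens used as holes are collected in a list [L], so that they are direct
    premises and induction provides a hypothesis for each. There is no rule for [Pub], as the system
    has no right rule for it. *)
Inductive synth G : tm -> Prop :=
| synth_in M N : nf M -> In N G -> equiv M N -> synth G M
| synth_sign M N : nf (Sign M N) -> synth G M -> synth G N -> synth G (Sign M N)
| synth_blind M N : nf (Blind M N) -> synth G M -> synth G N -> synth G (Blind M N)
| synth_pair M N : nf (Pair M N) -> synth G M -> synth G N -> synth G (Pair M N)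
| synth_enc M N : nf (Enc M N) -> synth G M -> synth G N -> synth G (Enc M N)
| synth_fn f l L C : nf (Fn f l) ->
    (forall e, In e L -> alien (thy T f) e (Fn f l)) ->
    (forall e, In e L -> synth G e) ->
    cinst (thy T f) (fun e => In e L \/ In e G) C -> approxE (Fn f l) C ->
    synth G (Fn f l).

Lemma synth_nf G M : synth G M -> nf M.
Proof. destruct 1; assumption. Qed.

Lemma synth_equiv G M : synth G M -> forall M', nf M' -> equiv M M' -> synth G M'.
Proof.
  assert (HS : forall M N : tm, imm_sub M N -> nf N -> nf M).
  { intros A B H. apply nf_subterm. apply rt_step. exact H. }
  induction 1 as [M N HM HN HE|M N Hnf H1 IH1 H2 IH2|M N Hnf H1 IH1 H2 IH2
    |M N Hnf H1 IH1 H2 IH2|M N Hnf H1 IH1 H2 IH2|f l L C Hnf HL HS' IH HC HE];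
    intros M' Hnf' Heq.
  - apply synth_in with N; auto. eapply rst_trans; [apply rst_sym|]; eassumption.
  - assert (Hsh := equiv_same_shape Heq).
    destruct M'; simpl in Hsh; try contradiction. destruct Hsh.
    apply synth_sign; [|apply IH1|apply IH2]; auto; eapply HS; [|exact Hnf'| |exact Hnf']; constructor.
  - assert (Hsh := equiv_same_shape Heq).
    destruct M'; simpl in Hsh; try contradiction. destruct Hsh.
    apply synth_blind; [|apply IH1|apply IH2]; auto; eapply HS; [|exact Hnf'| |exact Hnf']; constructor.
  - assert (Hsh := equiv_same_shape Heq).
    destruct M'; simpl in Hsh; try contradiction. destruct Hsh.
    apply synth_pair; [|apply IH1|apply IH2]; auto; eapply HS; [|exact Hnf'| |exact Hnf']; constructor.
  - assert (Hsh := equiv_same_shape Heq).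
    destruct M'; simpl in Hsh; try contradiction. destruct Hsh.
    apply synth_enc; [|apply IH1|apply IH2]; auto; eapply HS; [|exact Hnf'| |exact Hnf']; constructor.
  - assert (Hsh := equiv_same_shape Heq).
    destruct M' as [| | | | | | |g l']; simpl in Hsh; try contradiction. subst g.
    destruct (@cinst_bind (thy T f) (fun e => In e L \/ In e G)
      (fun e => (alien (thy T f) e (Fn f l') /\ synth G e) \/ In e G) C) as [C' [HC' HE']].
    + intros e [He|He].
      * destruct (alien_equiv Heq (HL e He)) as [e' [He' Hee]]. exists e'. split.
        -- constructor. left. split; [exact He'|]. apply (IH e He); [|exact Hee].
           eapply nf_subterm; [|exact Hnf']. apply (alien_subterm He').
        -- apply equiv_approxE. exact Hee.
      * exists e. split; [constructor; auto|apply rst_refl].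
    + exact HC.
    + apply cinst_finite in HC'. destruct HC' as [L' [HL' HC']].
      apply synth_fn with L' C'; auto; try (intros e He; apply (HL' e He)).
      eapply rst_trans; [apply rst_sym; apply equiv_approxE; exact Heq|].
      eapply rst_trans; eassumption.
Qed.

(** The last hypothesis mentions only analytic subterms of [M], so it passes to arguments and aliens
    of [M] in the induction. *)
Lemma synth_der G M : 0 < ntheories T -> (forall t, In t G -> nf t) -> synth G M ->
  (forall N, analytic N M -> der false G N -> In N G) -> der false G M.
Proof.
  intros Hn HG.
  induction 1 as [M N HM HN HE|M N Hnf H1 IH1 H2 IH2|M N Hnf H1 IH1 H2 IH2
    |M N Hnf H1 IH1 H2 IH2|M N Hnf H1 IH1 H2 IH2|f l L C Hnf HL HS IH HC HE]; intros Han.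
  (* The context is a bare hole, so any theory index would serve. *)
  - apply r_id with 0 N; auto; [split; assumption| |apply equiv_approxE; exact HE].
    constructor. exact HN.
  - apply r_signR; [split; assumption|apply IH1|apply IH2]; intros t Ht; apply Han;
      (eapply analytic_subterm; [exact Ht|apply rt_step; constructor]).
  - apply r_blindR; [split; assumption|apply IH1|apply IH2]; intros t Ht; apply Han;
      (eapply analytic_subterm; [exact Ht|apply rt_step; constructor]).
  - apply r_pR; [split; assumption|apply IH1|apply IH2]; intros t Ht; apply Han;
      (eapply analytic_subterm; [exact Ht|apply rt_step; constructor]).
  - apply r_eR; [split; assumption|apply IH1|apply IH2]; intros t Ht; apply Han;
      (eapply analytic_subterm; [exact Ht|apply rt_step; constructor]).
  - apply r_id with (thy T f) C; [split; assumption|apply V| |exact HE].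
    apply cinst_ctx_inst. revert HC. apply cinst_mono. intros e [He|He]; [|exact He].
    apply Han.
    + apply alien_analytic with (thy T f); [auto|]. simpl. apply Nat.eqb_refl.
    + apply IH; [exact He|]. intros N HN. apply Han.
      eapply analytic_subterm; [exact HN|]. apply (alien_subterm (HL e He)).
Qed.

(** The abstraction used for [id]: terms known from [B] survive and all others collapse to [c].
    Membership is tested up to [equiv] so that equivalent terms are treated alike. *)
Definition restrict_to (B : list tm) (c : tm) (t : tm) : tm :=
  if excluded_middle_informative (exists b, In b B /\ equiv t b) then t else c.

Lemma restrict_to_equiv B c : respects_equiv (restrict_to B c).
Proof.
  intros M N H. unfold restrict_to.
  destruct (excluded_middle_informative (exists b, In b B /\ equiv M b)) as [HM|HM],
    (excluded_middle_informative (exists b, In b B /\ equiv N b)) as [HN|HN].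
  - apply equiv_approxE. exact H.
  - exfalso. apply HN. destruct HM as [b [Hb E]]. exists b. split; [exact Hb|].
    eapply rst_trans; [apply rst_sym; exact H|exact E].
  - exfalso. apply HM. destruct HN as [b [Hb E]]. exists b. split; [exact Hb|].
    eapply rst_trans; [exact H|exact E].
  - apply rst_refl.
Qed.

Lemma alien_list i (L : list tm) : exists B, forall e,
  In e B <-> exists c, In c L /\ alien i e c.
Proof.
  assert (H1 : forall t, exists B, forall e, In e B <-> alien i e t).
  { intros t. induction t as [| | | | | | |f l IH] using term_list_ind;
      try (match goal with |- exists _, forall _, _ <-> alien _ _ ?u => exists [u] end;
        intros e; split; [intros [<-|[]]; constructor; reflexivity|
        intros He; apply alien_not_headed in He; [simpl; auto|reflexivity]]).
    destruct (headed i (Fn f l)) eqn:Hh.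
    - simpl in Hh. apply Nat.eqb_eq in Hh. apply list_choice in IH. destruct IH as [Ls HLs].
      exists (concat Ls). intros e. rewrite alien_Fn by exact Hh. rewrite in_concat.
      clear - HLs. induction HLs as [|t B l Ls H _ IH]; simpl.
      + split; intros [? [[] _]].
      + split.
        * intros [B' [[<-|HB'] He]]; [exists t; rewrite <- H; auto|].
          destruct IH as [IH _]. destruct IH as [t' [? ?]]; eauto.
        * intros [t' [[<-|Ht'] He]]; [exists B; rewrite H; auto|].
          destruct IH as [_ IH]. destruct IH as [t'' [? ?]]; eauto.
    - exists [Fn f l]. intros e. split.
      + intros [<-|[]]. constructor. exact Hh.
      + intros He. apply (alien_not_headed Hh) in He. simpl. auto. }
  induction L as [|t L [B HB]].
  - exists []. intros e. split; [intros []|intros [? [[] _]]].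
  - destruct (H1 t) as [B1 HB1]. exists (B1 ++ B). intros e.
    rewrite in_app_iff, HB, HB1. split.
    + intros [He|[c [Hc He]]]; simpl; eauto.
    + intros [c [[<-|Hc] He]]; eauto.
Qed.

(** * Closure of [synth G] under all rules, for a saturated [G] *)

Section Saturated.
Variables (G : list tm) (M0 : tm).
Hypothesis HT : 0 < ntheories T.
Hypothesis HG : forall t, In t G -> nf t.
Hypothesis HM0 : nf M0.
Hypothesis HS : saturated G M0.

Lemma saturated_analytic N t : In t G \/ t = M0 -> analytic N t ->
  der false G N -> In N G.
Proof.
  intros Ht Ha HN. apply HS. split; [apply (der_nf HN)|]. split.
  - exists t. split; [exact Ht|]. apply subterm_parts.
    destruct Ha as [[_ Ha]|Ha]; [exact Ha|apply cross_sub_subterm; exact Ha].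
  - intros HNM. destruct Ha as [[Hg Ha]|Ha].
    + apply r_gs with N; eauto. split; assumption.
    + apply r_cs with N; eauto. split; assumption.
Qed.

(** Supplies the first premise of [eL], [blindL1] and [blindL2], where the key is a subterm of a
    member of [G]. *)
Lemma synth_der_part N t : In t G -> subterm N t -> synth G N -> der false G N.
Proof.
  intros Ht Hs HN. apply synth_der; auto. intros A HA.
  apply saturated_analytic with t; auto. eapply analytic_subterm; eassumption.
Qed.

(** A left rule may add several terms [L] at once, whereas candidates are single terms; weakening
    from [N :: G] to [L ++ G] bridges the difference. *)
Lemma saturated_left N L t : In t G -> parts N t -> In N L ->
  (forall A, In A L -> nf A) ->
  (der false (L ++ G) M0 -> der false G M0) -> In N G.
Proof.
  intros Ht Hp HN HL Hd. apply HS. split; [auto|]. split; [eauto|].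
  intros H. apply Hd. apply (der_weakening H).
  - intros u [<-|Hu]; apply in_or_app; auto.
  - intros u Hu. apply in_app_or in Hu. destruct Hu; auto.
Qed.

Lemma imm_sub_nf N t : imm_sub N t -> nf t -> nf N.
Proof. intros H. apply nf_subterm. apply rt_step. exact H. Qed.

Lemma imm_sub_parts N t : imm_sub N t -> parts N t.
Proof. intros H. apply rt_step. constructor. exact H. Qed.

Lemma in_synth N : In N G -> synth G N.
Proof. intros H. apply synth_in with N; auto. apply rst_refl. Qed.

Lemma equiv_synth N N' : In N' G -> nf N -> equiv N N' -> synth G N.
Proof. intros H HN E. apply synth_in with N'; auto. Qed.

(** Peels off the [i]-layer, so that each hole is in [G] or is its own alien, on which abstraction
    acts as on an atom. *)
Lemma synth_layer i t : synth G t ->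
  exists C, cinst i (fun e => In e G \/ synth G e /\ headed i e = false) C /\ approxE t C.
Proof.
  intros Ht. destruct (headed i t) eqn:Hh.
  - destruct Ht as [M N _ HN HE| | | | |f l L C _ HL Hs HC HE]; try discriminate.
    + exists N. split; [constructor; auto|apply equiv_approxE; exact HE].
    + simpl in Hh. apply Nat.eqb_eq in Hh. subst i. exists C. split; [|exact HE].
      revert HC. apply cinst_mono. intros e [He|He]; [right|left; exact He].
      split; [auto|]. apply (alien_headed (HL e He)).
  - exists t. split; [constructor; auto|apply rst_refl].
Qed.

Lemma synth_alien_in i c e e' : In c G -> alien i e' c -> synth G e -> equiv e e' ->
  exists c', In c' G /\ equiv e c'.
Proof.
  intros Hc He' He Hee. destruct (headed i c) eqn:Hh.
  - exists e'. split; [|exact Hee].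
    apply saturated_analytic with c; [auto|apply (alien_analytic He' Hh)|].
    apply synth_der_part with c; [exact Hc|apply (alien_subterm He')|].
    apply synth_equiv with e; [exact He| |exact Hee].
    eapply nf_subterm; [apply (alien_subterm He')|auto].
  - apply (alien_not_headed Hh) in He'. subst. eauto.
Qed.

(* The holes of the context outside [G] and the aliens of [t] are
   irrelevant: they can all be abstracted to the same member [c] of [G]. *)
Lemma synth_abstract i t C c : nf t -> In c G ->
  cinst i (fun e => In e G \/ synth G e /\ headed i e = false) C -> approxE t C ->
  exists C', cinst i (fun e => (alien i e t /\ synth G e) \/ In e G) C' /\ approxE t C'.
Proof.
  intros Hnf Hc HC HE.
  (* [B] lists the aliens that must survive, so that abstraction fixes [t] and every member of
     [G]. *)
  destruct (alien_list i (t :: G)) as [B HB].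
  assert (Hid : forall u, In u (t :: G) -> abstract i (restrict_to B c) u = u).
  { intros u Hu. apply abstract_id. intros e He. unfold restrict_to.
    destruct excluded_middle_informative as [_|Hn]; [reflexivity|].
    exfalso. apply Hn. exists e. split; [apply HB; eauto|apply rst_refl]. }
  assert (HCnf : forall e, In e G \/ synth G e /\ headed i e = false -> nf e).
  { intros e [He|[He _]]; [auto|apply (synth_nf He)]. }
  destruct (@abstraction i nf (restrict_to B c) C t) as [_ HA].
  - apply restrict_to_equiv.
  - auto.
  - intros e He. destruct (cinst_alien HC He) as [p [Hp Hep]].
    exists e. split; [|apply rst_refl].
    eapply nf_subterm; [apply (alien_subterm Hep)|apply HCnf; exact Hp].
  - revert HC. apply cinst_wf. intros e He. apply HCnf. exact He.
  - exact Hnf.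
  - exact HE.
  - rewrite Hid in HA by (simpl; auto).
    destruct (@cinst_map i (fun e => In e G \/ synth G e /\ headed i e = false)
      (fun e => (alien i e t /\ synth G e) \/ In e G)
      (abstract i (restrict_to B c)) C) as [C' [HC' HE']].
    + intros f l. apply abstract_Fn.
    + intros e [He|[He Hh]].
      * rewrite Hid by (simpl; auto). exists e. split; [constructor; auto|apply rst_refl].
      * rewrite abstract_not_headed by exact Hh. unfold restrict_to.
        destruct excluded_middle_informative as [[e' [He' Hee]]|_].
        -- apply HB in He'. destruct He' as [d [[<-|Hd] He']].
           ++ exists e'. split; [|apply equiv_approxE; exact Hee]. constructor. left.
              split; [exact He'|]. apply synth_equiv with e; [exact He| |exact Hee].
              eapply nf_subterm; [apply (alien_subterm He')|exact Hnf].
           ++ destruct (synth_alien_in Hd He' He Hee) as [c' [Hc' E]].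
              exists c'. split; [constructor; auto|apply equiv_approxE; exact E].
        -- exists c. split; [constructor; auto|apply rst_refl].
    + exact HC.
    + exists C'. split; [exact HC'|]. eapply rst_trans; eassumption.
Qed.

(** If [t] is headed in theory [i], its context is reduced to holes allowed by [synth_fn]. If not,
    the context has collapsed to one alien, which is synthesised or comes from a member of [G]. *)
Lemma synth_id i t C : i < ntheories T -> nf t -> cinst i (synth G) C -> approxE t C ->
  synth G t.
Proof.
  intros Hi Hnf HC HE.
  destruct (cinst_bind (@synth_layer i) HC) as [C1 [HC1 HE1]].
  assert (HtC : approxE t C1) by (eapply rst_trans; eassumption).
  clear C HC HE HE1.
  set (B := fun e => nf e /\ (synth G e \/ exists c, In c G /\ alien i e c)).
  assert (HB : forall e, alien i e t -> exists e', B e' /\ equiv e e').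
  { apply (@abstraction i B (fun u => u) C1 t).
    - intros u v. apply equiv_approxE.
    - intros e He. apply He.
    - intros e He. exists e. split; [|apply rst_refl].
      destruct (cinst_alien HC1 He) as [p [[Hp|[Hp Hh]] Hep]].
      + split; [|eauto]. eapply nf_subterm; [apply (alien_subterm Hep)|auto].
      + apply (alien_not_headed Hh) in Hep. subst. split; [apply (synth_nf Hp)|auto].
    - revert HC1. apply cinst_wf. intros e [He|[He _]]; [apply HG; exact He|].
      apply (synth_nf He).
    - exact Hnf.
    - exact HtC. }
  destruct (headed i t) eqn:Hh.
  - assert (Hfin : exists C2, cinst i (fun e => (alien i e t /\ synth G e) \/ In e G) C2 /\
      approxE t C2).
    { destruct (classic (exists c, In c G)) as [[c Hc]|Hno].
      - apply synth_abstract with C1 c; assumption.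
      - exists t. split; [|apply rst_refl].
        generalize (cinst_aliens i (proj1 Hnf) Hh). apply cinst_mono. intros e He. left.
        split; [exact He|]. destruct (HB e He) as [e' [[_ [He'|[c [Hc _]]]] Hee]].
        + apply synth_equiv with e'; [exact He'| |apply rst_sym; exact Hee].
          eapply nf_subterm; [apply (alien_subterm He)|exact Hnf].
        + exfalso. eauto. }
    destruct Hfin as [C2 [HC2 HE2]]. apply cinst_finite in HC2. destruct HC2 as [L [HL HC2]].
    destruct t as [| | | | | | |f l]; try discriminate.
    simpl in Hh. apply Nat.eqb_eq in Hh. subst i.
    apply synth_fn with L C2; auto; intros e He; apply (HL e He).
  - destruct (HB t) as [e [[He [Hs|[c [Hc Hec]]]] Hte]]; [constructor; exact Hh| |].
    + apply synth_equiv with e; [exact Hs|exact Hnf|apply rst_sym; exact Hte].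
    + destruct (headed i c) eqn:Hhc.
      2:{ apply (alien_not_headed Hhc) in Hec. subst. apply equiv_synth with c; assumption. }
      assert (HeC : approxE e C1).
      { eapply rst_trans; [apply rst_sym; apply equiv_approxE; exact Hte|exact HtC]. }
      destruct (synth_abstract _ He Hc HC1 HeC) as [C2 [HC2 HE2]].
      (* As [e] is its own only alien, a hole outside [G] can only be [e], and then [e] is
         synthesised. Otherwise all holes lie in [G], [id] derives [e], and saturation puts it in
         [G]. *)
      destruct (@cinst_bind i (fun u => (alien i u e /\ synth G u) \/ In u G)
        (fun u => In u G \/ synth G e) C2) as [C3 [HC3 HE3]].
      2: exact HC2.
      { intros u [[Hu Hsu]|Hu]; exists u; (split; [constructor|apply rst_refl]); [|auto].
        right. rewrite (alien_not_headed (alien_headed Hec) Hu) in Hsu. exact Hsu. }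
      assert (Hse : synth G e).
      { destruct (classic (synth G e)) as [H|H]; [exact H|]. apply in_synth.
        apply saturated_analytic with c; [auto|apply (alien_analytic Hec Hhc)|].
        apply r_id with i C3; [split; assumption|exact Hi| |eapply rst_trans; eassumption].
        apply cinst_ctx_inst. revert HC3. apply cinst_mono. tauto. }
      apply synth_equiv with e; [exact Hse|exact Hnf|apply rst_sym; exact Hte].
Qed.

Lemma synth_pair_inv M N : synth G (Pair M N) -> synth G M /\ synth G N.
Proof.
  intros H. inversion H as [M' P Hnf HP HE| | |M' N' Hnf HM HN| |]; subst; [|auto].
  apply equiv_same_shape in HE as Hsh. destruct P as [| | | | |A B| |]; try contradiction.
  destruct Hsh as [EA EB].
  assert (nf A /\ nf B) as [HA HB].
  { split; (eapply imm_sub_nf; [|apply (HG _ HP)]; constructor). }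
  assert (Hd : forall C, In C [A; B] -> In C G).
  { intros C HC. apply saturated_left with [A; B] (Pair A B); auto.
    - apply imm_sub_parts. destruct HC as [<-|[<-|[]]]; constructor.
    - intros D [<-|[<-|[]]]; assumption.
    - apply r_pL; auto. split; assumption. }
  split; [apply equiv_synth with A|apply equiv_synth with B]; auto;
    try (apply Hd; simpl; auto); (eapply imm_sub_nf; [|exact Hnf]; constructor).
Qed.

Lemma synth_enc_inv M K : synth G (Enc M K) -> synth G K -> synth G M.
Proof.
  intros H HK. inversion H as [M' P Hnf HP HE| | | |M' N' Hnf HM HN|]; subst; [|auto].
  apply equiv_same_shape in HE as Hsh. destruct P as [| | | | | |A B|]; try contradiction.
  destruct Hsh as [EA EB].
  assert (nf A /\ nf B) as [HA HB].
  { split; (eapply imm_sub_nf; [|apply (HG _ HP)]; constructor). }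
  assert (HdB : der false G B).
  { apply synth_der_part with (Enc A B); [exact HP|apply rt_step; constructor|].
    apply synth_equiv with K; assumption. }
  apply equiv_synth with A; [|eapply imm_sub_nf; [|exact Hnf]; constructor|exact EA].
  apply saturated_left with [A; B] (Enc A B); auto.
  - apply imm_sub_parts. constructor.
  - simpl. auto.
  - intros D [<-|[<-|[]]]; assumption.
  - apply r_eL; auto. split; assumption.
Qed.

Lemma synth_blind_inv M K : synth G (Blind M K) -> synth G K -> synth G M.
Proof.
  intros H HK. inversion H as [M' P Hnf HP HE| |M' N' Hnf HM HN| | |]; subst; [|auto].
  apply equiv_same_shape in HE as Hsh. destruct P as [| | | |A B| | |]; try contradiction.
  destruct Hsh as [EA EB].
  assert (nf A /\ nf B) as [HA HB].
  { split; (eapply imm_sub_nf; [|apply (HG _ HP)]; constructor). }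
  assert (HdB : der false G B).
  { apply synth_der_part with (Blind A B); [exact HP|apply rt_step; constructor|].
    apply synth_equiv with K; assumption. }
  apply equiv_synth with A; [|eapply imm_sub_nf; [|exact Hnf]; constructor|exact EA].
  apply saturated_left with [A; B] (Blind A B); auto.
  - apply imm_sub_parts. constructor.
  - simpl. auto.
  - intros D [<-|[<-|[]]]; assumption.
  - apply r_blindL1; auto. split; assumption.
Qed.

(** A synthesised [Pub L] must come from [G]. The side condition of [signL] then follows by chaining
    the three equivalences of keys. *)
Lemma synth_sign_inv (M K L : tm) : synth G (Sign M K) -> synth G (Pub L) -> equiv K L ->
  synth G M.
Proof.
  intros H HL EKL. inversion H as [M' P Hnf HP HE|M' N' Hnf HM HN| | | |]; subst; [|auto].
  inversion HL as [M' Q HnfL HQ HEL| | | | |]; subst.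
  apply equiv_same_shape in HE as Hsh. destruct P as [| | |A B| | | |]; try contradiction.
  apply equiv_same_shape in HEL as HshL. destruct Q as [| |L'| | | | |]; try contradiction.
  destruct Hsh as [EA EB]. simpl in HshL.
  apply equiv_synth with A; [|eapply imm_sub_nf; [|exact Hnf]; constructor|exact EA].
  apply saturated_left with [A] (Sign A B); auto.
  - apply imm_sub_parts. constructor.
  - simpl. auto.
  - intros D [<-|[]]. eapply imm_sub_nf; [|apply (HG _ HP)]. constructor.
  - apply r_signL with B L'; auto; [split; assumption|].
    eapply rst_trans; [apply rst_sym; exact EB|].
    eapply rst_trans; [exact EKL|exact HshL].
Qed.

(** A signature made by the right rule is unblinded under the signature and signed again; one from
    [G] is handled by [blindL2] and saturation. *)
Lemma synth_unblind M R K : nf (Sign M K) ->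
  synth G (Sign (Blind M R) K) -> synth G R -> synth G (Sign M K).
Proof.
  intros HMK H HR. inversion H as [M' P Hnf HP HE|M' N' Hnf HM HN| | | |]; subst.
  2:{ apply synth_sign; auto. apply synth_blind_inv with R; assumption. }
  apply equiv_same_shape in HE as Hsh. destruct P as [| | |D B| | | |]; try contradiction.
  destruct Hsh as [ED EB]. apply equiv_same_shape in ED.
  destruct D as [| | | |A S| | |]; try contradiction. destruct ED as [EA ES].
  assert (HSB : subterm S (Sign (Blind A S) B)).
  { eapply rt_trans; apply rt_step; [apply is_blind2|apply is_sign1]. }
  assert (HS' : nf S) by (eapply nf_subterm; [exact HSB|auto]).
  assert (HdS : der false G S).
  { apply synth_der_part with (Sign (Blind A S) B); [exact HP|exact HSB|].
    apply synth_equiv with R; assumption. }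
  assert (E : equiv (Sign M K) (Sign A B)).
  { eapply rst_trans.
    - apply (@acEq_lift (isAC T) (fun t => Sign t K)); [|exact EA].
      intros P t u Htu. apply cs_sign1. exact Htu.
    - apply (@acEq_lift (isAC T) (fun t => Sign A t)); [|exact EB].
      intros P t u Htu. apply cs_sign2. exact Htu. }
  (* [Sign A B] is not a subterm of the member of [G], so its irreducibility is taken from the
     equivalent [Sign M K]. *)
  assert (HAB : nf (Sign A B)).
  { assert (HW : wf (Sign (Blind A S) B)) by apply (HG _ HP).
    inversion HW as [| | |? ? HW1 HW2| | | |]; subst.
    inversion HW1; subst. split; [constructor; assumption|].
    intros [N HN]. apply (proj2 HMK). exists N. apply (rstep_equiv_l E HN). }
  apply equiv_synth with (Sign A B); auto.
  apply saturated_left with [Sign A B; S] (Sign (Blind A S) B); auto.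
  - apply rt_step. apply part_unblind.
  - simpl. auto.
  - intros D [<-|[<-|[]]]; assumption.
  - apply r_blindL2; auto. split; assumption.
Qed.

(** The context [D] need only be synthesised, not contained in [G]. This makes cut immediate: the
    cut formula is synthesised by the first premise, so it may join the context of the second. [gs]
    and [cs] are treated in the same way. *)
Lemma der_synth b D t : der b D t -> (forall d, In d D -> synth G d) -> synth G t.
Proof.
  assert (Hcons : forall D d, (forall d, In d D -> synth G d) -> synth G d ->
    forall d', In d' (d :: D) -> synth G d').
  { intros D' d H Hd d' [<-|Hd']; auto. }
  induction 1 as [i G' M C Hnf Hi HC E|G' M N _ Hnf H1 IH1 H2 IH2|G' M N T0 Hnf Hin H1 IH1
    |G' M N Hnf H1 IH1 H2 IH2|G' M K N Hnf Hin H1 IH1 H2 IH2|G' M K Hnf H1 IH1 H2 IH2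
    |G' M K L N Hnf Hin HinL HKL H1 IH1|G' M K Hnf H1 IH1 H2 IH2
    |G' M K N Hnf Hin H1 IH1 H2 IH2|G' M K Hnf H1 IH1 H2 IH2
    |G' M R K N Hnf Hin H1 IH1 H2 IH2|G' A M Hnf _ _ H1 IH1 H2 IH2
    |G' N M Hnf _ H1 IH1 H2 IH2]; intros HD;
    try (specialize (IH1 HD)); try (destruct Hnf as [_ Hnf]).
  - apply synth_id with i C; auto. apply cinst_ctx_inst in HC. revert HC.
    apply cinst_mono. exact HD.
  - apply IH2, Hcons; auto.
  - destruct (synth_pair_inv (HD _ Hin)). apply IH1, Hcons; [apply Hcons|]; auto.
  - apply synth_pair; auto.
  - apply IH2, Hcons; [apply Hcons|]; auto. apply (synth_enc_inv (HD _ Hin) IH1).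
  - apply synth_enc; auto.
  - apply IH1, Hcons; auto. apply (synth_sign_inv (HD _ Hin) (HD _ HinL) HKL).
  - apply synth_sign; auto.
  - apply IH2, Hcons; [apply Hcons|]; auto. apply (synth_blind_inv (HD _ Hin) IH1).
  - apply synth_blind; auto.
  - apply IH2, Hcons; [apply Hcons; auto|]. apply synth_unblind with R; auto.
    apply der_nf_seq in H2. apply H2. left. reflexivity.
  - apply IH2, Hcons; auto.
  - apply IH2, Hcons; auto.
Qed.

Lemma saturated_der b D : incl D G -> der b D M0 -> der false G M0.
Proof.
  intros HD H. apply synth_der; auto.
  - apply (der_synth H). intros d Hd. apply in_synth. auto.
  - intros N HN. apply saturated_analytic with M0; auto.
Qed.

End Saturated.

End Theory.

(** * Admissibility of cut *)

Theorem theorem3 (T : theory_data) :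
  valid_theory T ->
  forall (G : list (term (sym T))) (M : term (sym T)),
    der T true G M -> der T false G M.
Proof.
  intros V G M H.
  destruct (der_nf_seq H) as [HG HM].
  destruct (saturation M G HG) as [G' [HGG' [HG' [HS Hback]]]].
  apply Hback. exact (saturated_der V (der_ntheories H) HG' HM HS HGG' H).
Qed.
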